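(* Let $p\ge 3$ and let $X\sim N_p(\theta,I_p)$ with unknown mean $\theta\in\mathbb{R}^p$. For $a\ge 0$ and $b>0$ consider the improper prior $\nu_{a,b}(d\theta)=(a+\|\theta\|^2)^{-b}\,d\theta$ on $\mathbb{R}^p$ (with $d\theta$ Lebesgue measure). Suppose either (A) $a>0$ and $b\in[p/2-1,p/2]$, or (B) $a=0$ and $b\in[p/2-1,p/2)$. Then $\nu_{a,b}$ (equivalently, its formal posterior $Q_{a,b}(d\theta\mid x)$) is strongly admissible.
   Context: For a statistical model $\{P(\cdot\mid\theta):\theta\in\Theta\}$ on a sample space $\mathcal{X}$ and a $\sigma$-finite measure $\nu$ on $\Theta$, the marginal measure is $M(B)=\int_\Theta P(B\mid\theta)\,\nu(d\theta)$. When $M$ is $\sigma$-finite, the formal posterior is a Markov kernel $Q(d\theta\mid x)$ with $P(dx\mid\theta)\nu(d\theta)=Q(d\theta\mid x)M(dx)$ as joint measures on $\mathcal{X}\times\Theta$. (For $\nu_{a,b}$ under (A) or (B), $M$ is $\sigma$-finite.) For a bounded measurable $\phi:\Theta\to\mathbb{R}$, loss $L(a,\theta)=(a-\phi(\theta))^2$, and an estimator $t$, the risk is $r(t,\theta)=\int (t(x)-\phi(\theta))^2P(dx\mid\theta)$. An estimator $t_0$ is almost-$\nu$-admissible if for every estimator $t$ with $r(t,\theta)\le r(t_0,\theta)$ for all $\theta$, the set $\{\theta: r(t,\theta)<r(t_0,\theta)\}$ has $\nu$-measure zero. The prior $\nu$ (equivalently $Q$) is strongly admissible if for every bounded measurable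 $\phi$ the formal Bayes estimator $\hat\phi(x)=\int\phi(\theta)Q(d\theta\mid x)$ is almost-$\nu$-admissible. *)

(* Defs.v *)
From HB Require Import structures.
From mathcomp Require Import all_boot all_order all_algebra.
From mathcomp Require Import all_classical all_reals all_analysis.
Set Implicit Arguments. Unset Strict Implicit. Unset Printing Implicit Defensive.
Import Order.TTheory GRing.Theory Num.Theory.
Import numFieldNormedType.Exports.
Local Open Scope classical_set_scope.
Local Open Scope ring_scope.
Local Open Scope ereal_scope.

Section Defs.
Context {R : realType}.

(* R^n is represented by n.-tuple R, with its canonical product (Borel)
   sigma-algebra from mathcomp-analysis. *)

(* Lebesgue integral over R^n of a nonnegative [0,+oo]-valued function,
   written as the iterated one-dimensional Lebesgue integral (Tonelli). *)
Fixpoint intRn (n : nat) : (n.-tuple R -> \bar R) -> \bar R :=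
  match n return (n.-tuple R -> \bar R) -> \bar R with
  | 0 => fun f => f [tuple]
  | n'.+1 => fun f =>
      \int[@lebesgue_measure R]_(y in [set: R])
         intRn (fun t : n'.-tuple R => f (cons_tuple y t))
  end.

Definition sqnorm (p : nat) (x : p.-tuple R) : R :=
  (\sum_(i < p) (tnth x i) ^+ 2)%R.
Definition sqdist (p : nat) (x y : p.-tuple R) : R :=
  (\sum_(i < p) (tnth x i - tnth y i) ^+ 2)%R.

Definition normal_dens (p : nat) (theta x : p.-tuple R) : R :=
  ((2 * pi) `^ (- (p%:R / 2)) * expR (- (sqdist x theta / 2)))%R.

Definition model (p : nat) (theta : p.-tuple R) (B : set (p.-tuple R)) : \bar R :=
  intRn (fun x => (normal_dens theta x)%:E * (\1_B x)%:E).

Definition prior_dens (a b : R) (p : nat) (theta : p.-tuple R) : R :=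
  ((a + sqnorm theta) `^ (- b))%R.

Definition prior (a b : R) (p : nat) (B : set (p.-tuple R)) : \bar R :=
  intRn (fun theta => (prior_dens a b theta)%:E * (\1_B theta)%:E).

Definition marg_dens (a b : R) (p : nat) (x : p.-tuple R) : \bar R :=
  intRn (fun theta => (prior_dens a b theta * normal_dens theta x)%:E).

(* Q is a formal posterior: P(dx|theta) nu(dtheta) = Q(dtheta|x) M(dx) as
   measures on X x Theta (X = Theta = R^p). *)
Definition formal_posterior (a b : R) (p : nat)
    (Q : R.-pker (p.-tuple R) ~> (p.-tuple R)) : Prop :=
  forall C : set (p.-tuple R * p.-tuple R), measurable C ->
    intRn (fun theta => (prior_dens a b theta)%:E *
       intRn (fun x => (normal_dens theta x)%:E * (\1_C (x, theta))%:E))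
    = intRn (fun x => marg_dens a b x * Q x [set theta | C (x, theta)]).

Definition risk (p : nat) (phi : p.-tuple R -> R) (t : p.-tuple R -> R)
    (theta : p.-tuple R) : \bar R :=
  intRn (fun x => (((t x - phi theta) ^+ 2) * normal_dens theta x)%:E).

Definition almost_nu_admissible (a b : R) (p : nat)
    (phi : p.-tuple R -> R) (t0 : p.-tuple R -> R) : Prop :=
  forall t : p.-tuple R -> R, measurable_fun setT t ->
    (forall theta, risk phi t theta <= risk phi t0 theta) ->
    exists N : set (p.-tuple R), [/\ measurable N,
      [set theta | risk phi t theta < risk phi t0 theta] `<=` N
      & prior a b N = 0].

Definition bayes_est (p : nat) (Q : R.-pker (p.-tuple R) ~> (p.-tuple R))
    (phi : p.-tuple R -> R) (x : p.-tuple R) : R :=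
  fine (\int[Q x]_(theta in [set: p.-tuple R]) (phi theta)%:E).

Definition strongly_admissible (a b : R) (p : nat) : Prop :=
  (exists Q : R.-pker (p.-tuple R) ~> (p.-tuple R), formal_posterior a b Q) /\
  forall Q : R.-pker (p.-tuple R) ~> (p.-tuple R), formal_posterior a b Q ->
  forall phi : p.-tuple R -> R, measurable_fun setT phi ->
    (exists K : R, forall theta, (`|phi theta| <= K)%R) ->
    almost_nu_admissible a b phi (bayes_est Q phi).

End Defs.

(* Main.v *)
Require Import Defs.
From HB Require Import structures.
From mathcomp Require Import all_boot all_order all_algebra.
From mathcomp Require Import finmap.
From mathcomp Require Import all_classical all_reals all_analysis.
From mathcomp Require Import measurable_realfun ring lra.
Set Implicit Arguments.
Unset Strict Implicit.
Unset Printing Implicit Defensive.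
Import Order.TTheory GRing.Theory Num.Theory.
Import numFieldNormedType.Exports.
Local Open Scope classical_set_scope.
Local Open Scope ring_scope.

(** Blyth's method. Let [t0] be the formal Bayes estimator of [phi], let [t]
    satisfy [risk t <= risk t0], and let [h] be bounded with [h ^+ 2]
    integrable for the prior [nu]. Disintegrating the joint measure along the
    posterior and comparing, for each [x], the posterior mean with [t x] gives
      [\int (risk t0 - risk t) * h ^+ 2 dnu
         <= 16 * K ^+ 2 * \int nu(dth) \int P(dx | th) (h th - h x) ^+ 2]
    whenever [`|phi| <= K]: the cost of weighting the loss by [h ^+ 2] is at most
    the Dirichlet form of [h] for the joint law of [(x, th)], and neither the
    posterior nor the marginal appears in it.
    For [h] close to [(1 + |th| ^+ 2) `^ (- e)], which tends to [1] with [e],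
    the Dirichlet form is
      [O(e ^+ 2 * \int (1 + |th| ^+ 2) `^ (- 1 - 2 * e) nu(dth))]
    by Peetre's inequality and Gaussian moments. As [b >= p / 2 - 1], this last
    integral grows at most like [\int (1 + |th| ^+ 2) `^ (- p / 2 - 2 * e)],
    that is like [1 / e], so the Dirichlet form is [O(e)] and [risk t = risk t0]
    holds [nu]-almost everywhere. *)

(** * Lebesgue measure on tuples *)

Section lebesgue_tuple.
Local Open Scope ereal_scope.

(** The constant compared with [h] at [x] is free; taking [h x], not the posterior mean of [h], is
    what removes the posterior: in the joint law the parameter can be fixed first and [x] integrated
    against a plain Gaussian. The power of 1 + |th|^2 cannot itself serve as [h]: when b < p/2 the
    mass of [nu] grows polynomially and the square of a small negative power is not integrable.
    Subtracting [e] and truncating at 0 gives compact support without enlarging any increment of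
    [h]. Integrability of [h ^+ 2] matters because the two weighted risks must be finite to be
    subtracted. Integrals over R^p are iterated one-dimensional integrals, so polar coordinates are
    replaced by two devices. At infinity the l1-norm is used: its powers integrate exactly, one
    coordinate at a time. At the origin, for a = 0, the singularity |th|^(-2b) is shared equally
    among the [p] coordinates, and each share is integrable because b < p/2. *)

Lemma sigma_finite_pushforward d1 d2 (T1 : measurableType d1)
    (T2 : measurableType d2) (R : realType)
    (mu : {measure set T1 -> \bar R}) (f : T1 -> T2) (g : T2 -> T1) :
  sigma_finite setT mu -> measurable_fun [set: T1] f ->
    measurable_fun [set: T2] g -> cancel f g ->
  {nu : {sigma_finite_measure set T2 -> \bar R} |
    forall h : T2 -> \bar R, measurable_fun [set: T2] h ->
      (forall y, 0 <= h y) -> \int[nu]_y h y = \int[mu]_x h (f x)}.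
Proof.
move=> sfmu mf mg fK.
pose M : {measure set T2 -> \bar R} :=
  measure_function_pushforward__canonical__measure_function_Measure mu mf.
have sfM : sigma_finite setT M.
  (* A pushforward need not be sigma-finite. The left inverse [g] carries the exhaustion over to
     [T2], and [g \o f = id] keeps each measure finite. *)
  have [F FT mF] := sfmu; exists (fun n => g @^-1` (F n)).
    by rewrite -preimage_bigcup -FT preimage_setT.
  move=> n; have [mFn Fn] := mF n; split.
    by rewrite -[X in measurable X]setTI; exact: mg.
  rewrite /M/= /pushforward -comp_preimage (_ : g \o f = id) ?preimage_id//.
  by apply/funext => x /=; rewrite fK.
pose H1 := isSFinite.Build _ _ _ (Measure.sort M)
  (sfinite_measure_sigma_finite sfM).
pose H2 := isSigmaFinite.Build _ _ _ (Measure.sort M) sfM.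
exists (HB.pack_for (SigmaFiniteMeasure.type T2 R) (Measure.sort M) H1 H2).
move=> h mh h0; rewrite -[RHS]/(\int[mu]_(x in f @^-1` setT) (h \o f) x).
by rewrite -ge0_integral_pushforward//.
Qed.

Lemma measurable_cons_tuple (R : realType) (n : nat) :
  measurable_fun [set: measurableTypeR R * n.-tuple R]
    (fun z => cons_tuple z.1 z.2 : n.+1.-tuple R).
Proof.
exact: (@measurable_cons _ _ _ R (fst : measurableTypeR R * n.-tuple R -> R)
  n snd measurable_fst measurable_snd).
Qed.

(** Realizing the iterated integral by a single measure gives access to monotone convergence, Fatou
    and Tonelli. The product of Lebesgue measure with the previous measure is pushed along
    [cons_tuple]; sigma-finiteness is carried through the induction because Tonelli needs it at the
    next step. *)
Lemma intRn_measure (R : realType) (n : nat) :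
  {mu : {sigma_finite_measure set (n.-tuple R) -> \bar R} |
   forall f : n.-tuple R -> \bar R, measurable_fun [set: n.-tuple R] f ->
     (forall x, 0 <= f x) -> intRn f = \int[mu]_x f x}.
Proof.
elim: n => [|n [mu muE]].
  exists (dirac [tuple]) => f mf f0 /=.
  by rewrite integral_dirac// diracT mul1e.
pose c (z : measurableTypeR R * n.-tuple R) : n.+1.-tuple R :=
  cons_tuple z.1 z.2.
have mc : measurable_fun [set: measurableTypeR R * n.-tuple R] c :=
  @measurable_cons_tuple R n.
pose g (t : n.+1.-tuple R) : measurableTypeR R * n.-tuple R :=
  (thead t, [tuple of behead t]).
have mg : measurable_fun [set: n.+1.-tuple R] g.
  apply/measurable_fun_pairP; split.
    exact: (@measurable_tnth _ R n.+1 ord0).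
  exact: measurable_behead.
have cK : cancel c g.
  by case=> y t; rewrite /g /c/=; congr pair; exact/val_inj.
pose m12 : {measure set (measurableTypeR R * n.-tuple R)%type -> \bar R} :=
  @lebesgue_measure R \x mu.
have sf12 : sigma_finite setT m12.
  (* The canonical instance is overwritten in the library by the one for
     subprobabilities, hence this access to the underlying mixin. *)
  by case: (lebesgue_integral_fubini.measure_function_Measure_isSigmaFinite__to__measure_function_isSigmaFinite
    (@lebesgue_measure R) mu).
have [nu nuE] := sigma_finite_pushforward sf12 mc mg cK.
exists nu => f mf f0.
rewrite nuE// fubini_tonelli1//=; last first.
  exact: (measurableT_comp mf).
apply: eq_integral => y _ /=; rewrite muE//.
exact: (measurableT_comp mf (measurableT_comp mc (pair1_measurable y))).
Qed.

Definition lebRn (R : realType) (n : nat) :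
  {sigma_finite_measure set (n.-tuple R) -> \bar R} := sval (intRn_measure R n).

Lemma intRnE (R : realType) (n : nat) (f : n.-tuple R -> \bar R) :
  measurable_fun [set: n.-tuple R] f -> (forall x, 0 <= f x) ->
  intRn f = \int[lebRn R n]_x f x.
Proof. exact: (svalP (intRn_measure R n)). Qed.

End lebesgue_tuple.

(** * One-dimensional integrals *)

Section one_dim.
Context {R : realType}.
Local Notation mu := (@lebesgue_measure R).

Lemma ge0_integral_norm_FTC (f F : R -> R) (l : R) :
  (forall x : R, 0 <= x -> 0 <= f x) ->
  (forall x : R, 0 <= x -> {for x, continuous f}) ->
  (forall x : R, 0 <= x -> is_derive x 1 F (f x)) ->
  F x @[x --> +oo] --> l ->
  (\int[mu]_x (f `|x|)%:E = 2%:E * (l - F 0)%:E)%E.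
Proof.
move=> f0 cf dF Fl.
rewrite (@ge0_symfun_integralT _ (fun x => f `|x|)) //; last 3 first.
- by move=> x; exact: f0.
- move=> x; apply: continuous_comp; first exact: norm_continuous.
  exact: cf.
- by move=> x /=; rewrite normrN.
congr (2%:E * _)%E; rewrite -set_itvcy.
rewrite (@eq_integral _ _ _ mu _ (fun x => (f x)%:E)); last first.
  by move=> x; rewrite inE/= in_itv/= andbT => x0; rewrite ger0_norm.
rewrite (ge0_continuous_FTC2y _ _ Fl)//.
- apply/continuous_within_itvcyP; split.
    by move=> x; rewrite in_itv/= andbT => /ltW; exact: cf.
  by apply: cvg_at_right_filter; exact: cf.
- by move=> x /ltW x0; have [] := dF _ x0.
- apply: cvg_at_right_filter; apply: differentiable_continuous.
  by apply/derivable1_diffP; have [] := dF _ (lexx 0).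
- move=> x; rewrite in_itv/= andbT => /ltW x0.
  by rewrite derive1E; have [] := dF _ x0.
Qed.

Lemma cvg_powRN (a : R) : 0 < a -> x `^ (- a) @[x --> +oo] --> 0.
Proof.
move=> a0; under eq_fun do rewrite powRN.
apply/gtr0_cvgV0; first by near=> x; apply: powR_gt0; near: x;
  exact: nbhs_pinfty_gt.
apply/cvgryPge => A; near=> x.
have A1 : 0 <= `|A| + 1 by rewrite addr_ge0.
have xA : (`|A| + 1) `^ a^-1 <= x by near: x; exact: nbhs_pinfty_ge.
apply: (@le_trans _ _ (`|A| + 1)); first by rewrite (le_trans (ler_norm A))//
  lerDl.
rewrite -[leLHS]powRr1// -[X in _ `^ X <= _](mulVf (lt0r_neq0 a0)) powRrM.
by apply: ge0_ler_powR => //; rewrite ?nnegrE ?powR_ge0// ?ltW//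
  (le_trans _ xA)// powR_ge0.
Unshelve. all: by end_near. Qed.

Lemma is_derive_addl (m x : R) : is_derive x 1 (fun y => m + y) 1.
Proof.
by rewrite -[X in is_derive _ _ _ X]add0r;
  exact: (@is_deriveD _ _ _ (cst m) id).
Qed.

Lemma is_derive_powR_shift (m c x : R) : 0 < m + x ->
  is_derive x 1 (fun y => (m + y) `^ c) (c * (m + x) `^ (c - 1)).
Proof.
move=> mx; have := is_derive1_powR c mx => H.
have K := is_derive_addl m x.
by have := @is_derive1_comp R (@powR R ^~ c) (fun y => m + y) _ _ _ H K;
  rewrite mulr1.
Qed.

Lemma continuous_powR_shift (m c x : R) : 0 < m + x ->
  {for x, continuous (fun y => (m + y) `^ c)}.
Proof.
move=> mx; apply: differentiable_continuous; apply/derivable1_diffP.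
by have [] := is_derive_powR_shift c mx.
Qed.

Lemma integral_powR_norm (m a : R) : 0 < m -> 0 < a ->
  (\int[mu]_x ((m + `|x|) `^ (- 1 - a))%:E = (2 / a * m `^ (- a))%:E)%E.
Proof.
move=> m0 a0.
have mx (x : R) : 0 <= x -> 0 < m + x by move=> x0; rewrite ltr_pwDl.
transitivity (2%:E * (0 - (- a^-1) * (m + 0) `^ (- a))%:E)%E; last first.
  by rewrite -EFinM addr0 sub0r mulNr opprK mulrA.
apply: (@ge0_integral_norm_FTC (fun x => (m + x) `^ (- 1 - a))
  (fun x => (- a^-1) * (m + x) `^ (- a)) 0).
- by move=> x _; exact: powR_ge0.
- by move=> x /mx; exact: continuous_powR_shift.
- move=> x /mx x0.
  have := is_derive_powR_shift (- a) x0 => H.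
  have := @is_deriveZ _ _ _ _ (- a^-1) _ _ _ H.
  by rewrite /GRing.scale/= mulrA mulrNN mulVf ?gt_eqF// mul1r [- a - 1]addrC.
- rewrite -[X in _ --> X](mulr0 (- a^-1)); apply: cvgMr.
  apply: (@cvg_comp _ _ _ (fun x => m + x) (@powR R ^~ (- a)) _ _ _ _
    (cvg_powRN a0)).
  exact: cvg_addrl.
Qed.

(* [((m + y) / (1 + y)) `^ (1 - q)] is up to a constant a primitive of the
   integrand on the positive half-line, which makes the bound uniform in [m]. *)
Lemma integral_powR_norm_local (m q : R) : 0 < m -> m <= 2^-1 -> q < 1 ->
  (\int[mu]_x (((m + `|x|) / (1 + `|x|)) `^ (- q) * (1 + `|x|) ^- 2)%:E
    <= (4 / (1 - q))%:E)%E.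
Proof.
move=> m0 m12 q1.
have m1 : 0 < 1 - m by lra.
have q0 : 0 < 1 - q by lra.
have nz (x : R) : 0 <= x -> 1 + x != 0 by move=> x0; rewrite gt_eqF// ltr_pwDl.
pose g (x : R) := 1 - (1 - m) * (1 + x)^-1.
have gE (x : R) : 0 <= x -> (m + x) / (1 + x) = g x.
  by move=> x0; rewrite /g; field; exact: nz.
have g0 (x : R) : 0 <= x -> 0 < g x.
  by move=> x0; rewrite -gE// divr_gt0// ltr_pwDl.
have dg (x : R) : 0 <= x -> is_derive x 1 g ((1 - m) * (1 + x) ^- 2).
  move=> x0.
  have K := is_derive_addl 1 x.
  have KV := @is_deriveV R (fun y => 1 + y) x 1 1 (nz _ x0) K.
  have H := is_deriveZ (1 - m) KV.
  have H0 : is_derive x 1 (cst (1 : R)) 0 by exact: is_derive_cst.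
  apply: (is_derive_eq (is_deriveB H0 H)).
  by rewrite /GRing.scale/=; field; exact: nz.
have dF (x : R) : 0 <= x -> is_derive x 1
  (fun y => (((1 - q) * (1 - m))^-1) * g y `^ (1 - q))
    (g x `^ (- q) * (1 + x) ^- 2).
  move=> x0.
  have H1 := is_derive1_powR (1 - q) (g0 _ x0).
  have H2 := dg _ x0.
  have H3 := @is_derive1_comp R (@powR R ^~ (1 - q)) g _ _ _ H1 H2.
  have := @is_deriveZ _ _ _ _ (((1 - q) * (1 - m))^-1) _ _ _ H3.
  rewrite /GRing.scale/= (_ : 1 - q - 1 = - q); last by ring.
  move=> H; apply: (is_derive_eq H).
  field; rewrite nz//=; apply/andP; split; lra.
rewrite (_ : (fun x : R => _) = (fun x : R =>
  (g `|x| `^ (- q) * (1 + `|x|) ^- 2)%:E)); last first.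
  by apply/funext => x; rewrite gE.
apply: (@le_trans _ _ (2%:E * (((1 - q) * (1 - m))^-1 -
  (((1 - q) * (1 - m))^-1) * g 0 `^ (1 - q))%:E)%E); last first.
  rewrite -EFinM lee_fin.
  (* As [m <= 2^-1], the inverse of 1 - m is at most 2; the two half-lines give the other factor 2
     of [4 / (1 - q)]. *)
  have B : ((1 - q) * (1 - m))^-1 <= 2 / (1 - q).
    by rewrite invfM mulrC ler_pM2r ?invr_gt0// invf_ple ?posrE//; lra.
  have C : 0 <= ((1 - q) * (1 - m))^-1 * g 0 `^ (1 - q).
    by rewrite mulr_ge0 ?powR_ge0// invr_ge0 mulr_ge0// ltW.
  rewrite (_ : 4 / (1 - q) = 2 * (2 / (1 - q))); last by field; lra.
  by rewrite ler_pM2l//; lra.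
rewrite le_eqVlt; apply/orP; left; apply/eqP.
apply: (@ge0_integral_norm_FTC (fun x => g x `^ (- q) * (1 + x) ^- 2)
  (fun y => (((1 - q) * (1 - m))^-1) * g y `^ (1 - q))
    (((1 - q) * (1 - m))^-1)).
- by move=> x x0; rewrite mulr_ge0 ?powR_ge0// invr_ge0 exprn_ge0// addr_ge0.
- move=> x x0.
  have H1 : {for x, continuous (fun y => g y `^ (- q))}.
    apply: differentiable_continuous; apply/derivable1_diffP.
    have H1 := is_derive1_powR (- q) (g0 _ x0).
    have H2 := dg _ x0.
    by have [] := @is_derive1_comp R (@powR R ^~ (- q)) g _ _ _ H1 H2.
  apply: cvgM => //; apply: cvgV; first by rewrite expf_neq0// nz.
  under eq_fun do rewrite expr2.
  by rewrite expr2; apply: cvgM; apply: cvgD;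
    [exact: cvg_cst|exact: cvg_id|exact: cvg_cst|exact: cvg_id].
- have gy : g x @[x --> +oo] --> (1 : R).
    rewrite /g -[X in _ --> X](subr0 1) -(mulr0 (1 - m)).
    apply: cvgB; first exact: cvg_cst.
    apply: cvgMr; apply/gtr0_cvgV0; last exact: cvg_addrl.
    near=> x; have : 0 < x by near: x; exact: nbhs_pinfty_gt.
    by lra.
  have p1 : {for 1, continuous (@powR R ^~ (1 - q))}.
    apply: differentiable_continuous; apply/derivable1_diffP.
    by have [] := is_derive1_powR (1 - q) (@ltr01 R).
  rewrite -[X in _ --> X]mulr1; apply: cvgMr.
  by have := cvg_comp _ _ gy p1; rewrite /= powR1.
Unshelve. all: by end_near. Qed.

End one_dim.

(** * Iterated integrals of powers of the l1-norm and of products *)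

Lemma measurable_funpowR d (T : measurableType d) (R : realType) (f : T -> R)
  (c : R) :
  measurable_fun [set: T] f -> measurable_fun [set: T] (fun x => f x `^ c).
Proof. by move=> mf; exact: (measurableT_comp (measurable_powR c)). Qed.

Section multi_dim.
Context {R : realType}.
Local Notation mu := (@lebesgue_measure R).

Lemma integral_lebRnS (n : nat) (f : n.+1.-tuple R -> \bar R) :
  measurable_fun [set: n.+1.-tuple R] f -> (forall x, 0 <= f x)%E ->
  (\int[lebRn R n.+1]_x f x =
   \int[mu]_y \int[lebRn R n]_t f (cons_tuple y t))%E.
Proof.
move=> mf f0; rewrite -intRnE//=; apply: eq_integral => y _.
rewrite intRnE//; apply: (measurableT_comp mf).
exact: (measurableT_comp (@measurable_cons_tuple R n) (pair1_measurable y)).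
Qed.

Lemma integral_lebRn0 (f : 0.-tuple R -> \bar R) :
  measurable_fun [set: 0.-tuple R] f -> (forall x, 0 <= f x)%E ->
  (\int[lebRn R 0]_x f x = f [tuple])%E.
Proof. by move=> mf f0; rewrite -intRnE. Qed.

Definition norm1 (n : nat) (x : n.-tuple R) : R := \sum_(i < n) `|tnth x i|.

Lemma measurable_norm1 (n : nat) : measurable_fun [set: n.-tuple R] (@norm1 n).
Proof.
apply: measurable_sum => i; apply: measurableT_comp => //;
  exact: measurable_tnth.
Qed.

Lemma norm1_ge0 (n : nat) (x : n.-tuple R) : 0 <= norm1 x.
Proof. by apply: sumr_ge0 => i _. Qed.

Lemma norm1_cons (n : nat) (y : R) (t : n.-tuple R) :
  norm1 (cons_tuple y t) = `|y| + norm1 t.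
Proof.
rewrite /norm1 big_ord_recl tnth0; congr (_ + _).
by apply: eq_bigr => i _; rewrite tnthS.
Qed.

(** The l1-norm is additive along [cons_tuple]: with the first coordinate [y] fixed, the inner
    integral is of the same kind with m + |y| and 1 + a, and the outer one is one-dimensional. Hence
    an exact value, by an induction general in [m] and [a]. Only the factor 2 / a of index 0 is
    unbounded as [a] tends to 0; it is the source of all later bounds in 1 / e. *)
Lemma integral_powR_norm1 (n : nat) (m a : R) : 0 < m -> 0 < a ->
  (\int[lebRn R n]_x ((m + norm1 x) `^ (- n%:R - a))%:E =
   ((\prod_(k < n) (2 / (k%:R + a))) * m `^ (- a))%:E)%E.
Proof.
elim: n m a => [|n IH] m a m0 a0.
  rewrite integral_lebRn0//; last by move=> x; rewrite lee_fin powR_ge0.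
    by rewrite /norm1 !big_ord0 addr0 mul1r oppr0 add0r.
  apply/measurable_EFinP; apply: measurable_funpowR.
  by apply: measurable_funD => //; exact: measurable_norm1.
rewrite integral_lebRnS; last 2 first.
- apply/measurable_EFinP; apply: measurable_funpowR.
  by apply: measurable_funD => //; exact: measurable_norm1.
- by move=> x; rewrite lee_fin powR_ge0.
under eq_integral => y _.
  under eq_integral => t _.
    rewrite norm1_cons addrA.
    rewrite (_ : - n.+1%:R - a = - n%:R - (1 + a)); last by rewrite -natr1;
      ring.
    over.
  rewrite IH; [|by rewrite ltr_pwDl|by rewrite addr_gt0].
  rewrite EFinM opprD.
  over.
rewrite ge0_integralZl//; last 3 first.
- apply/measurable_EFinP; apply: measurable_funpowR.
  by apply: measurable_funD => //; exact: measurableT_comp.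
- by move=> x _; rewrite lee_fin powR_ge0.
- by rewrite lee_fin prodr_ge0// => i _;
    rewrite divr_ge0// addr_ge0// addr_ge0// ltW.
rewrite integral_powR_norm// -EFinM mulrA; congr (_ * _)%:E.
rewrite [RHS]big_ord_recl add0r mulrC; congr (_ * _).
by apply: eq_bigr => i _; rewrite lift0 -[i.+1%:R]natr1 addrA.
Qed.

Lemma le_integral_prod (n : nat) (f : 'I_n -> R -> R) (C : R) : 0 <= C ->
  (forall i, measurable_fun [set: R] (f i)) -> (forall i x, 0 <= f i x) ->
  (forall i, \int[mu]_x (f i x)%:E <= C%:E)%E ->
  (\int[lebRn R n]_x (\prod_(i < n) f i (tnth x i))%:E <= (C ^+ n)%:E)%E.
Proof.
move=> C0; elim: n f => [|n IH] f mf f0 fC.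
  rewrite integral_lebRn0//; first by rewrite big_ord0 expr0.
    by apply/measurable_EFinP; apply: measurable_prod => -[].
  by move=> x; rewrite lee_fin prodr_ge0.
rewrite integral_lebRnS; last 2 first.
- apply/measurable_EFinP; apply: measurable_prod => i _.
  by apply: measurableT_comp; [exact: mf|exact: measurable_tnth].
- by move=> x; rewrite lee_fin prodr_ge0.
have mp : measurable_fun [set: n.-tuple R]
    (fun t => (\prod_(i < n) f (lift ord0 i) (tnth t i))%:E).
  apply/measurable_EFinP; apply: measurable_prod => i _.
  by apply: measurableT_comp; [exact: mf|exact: measurable_tnth].
under eq_integral => y _.
  under eq_integral => t _.
    rewrite big_ord_recl tnth0 EFinM.
    under eq_bigr do rewrite tnthS.
    over.
  rewrite ge0_integralZl//; last 2 first.
  - by move=> x _; rewrite lee_fin prodr_ge0.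
  - by rewrite lee_fin.
  over.
rewrite ge0_integralZr//; last 3 first.
- by apply/measurable_EFinP; exact: mf.
- by move=> x _; rewrite lee_fin.
- by apply: integral_ge0 => x _; rewrite lee_fin prodr_ge0.
rewrite exprS EFinM; apply: lee_pmul => //.
- by apply: integral_ge0 => x _; rewrite lee_fin.
- by apply: integral_ge0 => x _; rewrite lee_fin prodr_ge0.
- exact: (IH (fun i => f (lift ord0 i))).
Qed.

End multi_dim.

(** * Integrability of the prior against decaying weights *)

(** Fatou's lemma, since [f] lies below the lower limit of [g]. The rank may depend on the point,
    which is what every passage to the limit below needs: removing the regularization of the
    singularity, letting the cutoff tend to 1, and deducing a null set from a null integral. *)
Lemma le_integral_eventually d (T : measurableType d) (R : realType)
    (mu : {measure set T -> \bar R}) (f : T -> \bar R) (g : nat -> T -> \bar R)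
    (C : \bar R) :
  measurable_fun [set: T] f -> (forall x, 0 <= f x)%E ->
  (forall n, measurable_fun [set: T] (g n)) -> (forall n x, 0 <= g n x)%E ->
  (forall x, exists N, forall n, (N <= n)%N -> f x <= g n x)%E ->
  (forall n, \int[mu]_x g n x <= C)%E -> (\int[mu]_x f x <= C)%E.
Proof.
move=> mf f0 mg g0 fg gC.
apply: (@le_trans _ _ (\int[mu]_x limn_einf (g ^~ x))%E).
  apply: ge0_le_integral => //.
  - apply: measurableT_comp => //; apply: measurable_fun_limn_esup => n.
    exact: measurableT_comp.
  - move=> x _; have [N fgN] := fg x; rewrite limn_einf_lim.
    apply: (@le_trans _ _ (einfs (g ^~ x) N)).
      by apply: le_ereal_inf_tmp => _ [n /= Nn <-]; exact: fgN.
    have /cvg_lim -> // := @cvg_einfs_sup _ (g ^~ x).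
    by apply: ereal_sup_ubound; exists N.
apply: (le_trans (fatou _ _ _ _)) => //.
rewrite limn_einf_lim; apply: lime_le; first exact: is_cvg_einfs.
apply: nearW => n; apply: (le_trans _ (gC n)).
by apply: ereal_inf_lbound; exists n => /=.
Qed.

Section weights.
Context {R : realType}.

Lemma le_powRN (x y c : R) : 0 < x -> x <= y -> 0 <= c -> y `^ (- c) <=
  x `^ (- c).
Proof.
move=> x0 xy c0; have y0 := lt_le_trans x0 xy.
rewrite !powRN lef_pV2 ?posrE ?powR_gt0//.
by apply: ge0_ler_powR; rewrite ?nnegrE// ltW.
Qed.

Lemma sqnorm_ge0 (n : nat) (x : n.-tuple R) : 0 <= sqnorm x.
Proof. by apply: sumr_ge0 => i _; exact: sqr_ge0. Qed.

Lemma le_sqnorm (n : nat) (x : n.-tuple R) (i : 'I_n) : (tnth x i) ^+ 2 <=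
  sqnorm x.
Proof. by rewrite /sqnorm (bigD1 i)//= lerDl sumr_ge0// => j _;
  exact: sqr_ge0. Qed.

Lemma le_sqrt_sqnorm (n : nat) (x : n.-tuple R) (i : 'I_n) :
  `|tnth x i| <= Num.sqrt (sqnorm x).
Proof. by rewrite -sqrtr_sqr ler_wsqrtr// le_sqnorm. Qed.

(** Each coordinate is bounded by the Euclidean norm. The constant is crude, but only the order of
    growth at infinity matters. *)
Lemma sqnorm_norm1 (n : nat) (x : n.-tuple R) : (0 < n)%N ->
  (1 + norm1 x) ^+ 2 <= (2 * n%:R ^+ 2) * (1 + sqnorm x).
Proof.
move=> n0; set s := Num.sqrt (sqnorm x).
have s0 : 0 <= s by exact: sqrtr_ge0.
have sE : s ^+ 2 = sqnorm x by rewrite sqr_sqrtr// sqnorm_ge0.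
have n1 : 1 <= n%:R :> R by rewrite ler1n.
have xs : norm1 x <= n%:R * s.
  apply: (@le_trans _ _ (\sum_(i < n) s)).
    by apply: ler_sum => i _; exact: le_sqrt_sqnorm.
  by rewrite sumr_const card_ord -[leLHS]mulr_natl.
have x0 := norm1_ge0 x; rewrite -sE.
have n2 : 1 <= n%:R ^+ 2 :> R by rewrite exprn_ege1.
have : (1 + norm1 x) ^+ 2 <= (1 + n%:R * s) ^+ 2.
  by rewrite lerXn2r ?nnegrE ?addr_ge0// ?lerD2l// mulr_ge0.
by have := sqr_ge0 (1 - n%:R * s); nra.
Qed.

Lemma measurable_sqnorm (n : nat) : measurable_fun [set: n.-tuple R]
  (@sqnorm R n).
Proof.
apply: measurable_sum => i; apply: measurable_funX; exact: measurable_tnth.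
Qed.

Lemma measurable_prior_dens (a b : R) (n : nat) :
  measurable_fun [set: n.-tuple R] (@prior_dens R a b n).
Proof.
by apply: measurable_funpowR; apply: measurable_funD => //;
  exact: measurable_sqnorm.
Qed.

Lemma measurable_weight (c : R) (n : nat) :
  measurable_fun [set: n.-tuple R] (fun x => (1 + sqnorm x) `^ c).
Proof.
by apply: measurable_funpowR; apply: measurable_funD => //;
  exact: measurable_sqnorm.
Qed.

Lemma integral_weight_le (p : nat) : (0 < p)%N ->
  exists2 C : R, 0 <= C & forall e : R, 0 < e -> e <= 1 ->
  (\int[lebRn R p]_x ((1 + sqnorm x) `^ (- (p%:R / 2) - 2 * e))%:E <=
    (C / e)%:E)%E.
Proof.
move=> p0; pose K : R := 2 * p%:R ^+ 2.
have K1 : 1 <= K.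
  have : 1 <= p%:R ^+ 2 :> R by rewrite exprn_ege1// ler1n.
  by rewrite /K; lra.
(* The exponent p/2 + 2e of [K] is at most p/2 + 2 because [e <= 1] and [K >= 1]. In the product of
   the 2 / (k + 4e), the factors with k >= 1 are at most 2 and the factor of index 0 is at most 2 /
   e. *)
exists (K `^ (p%:R / 2 + 2) * 2 ^+ p); first by rewrite mulr_ge0 ?powR_ge0.
move=> e e0 e1.
have p0' : 0 <= p%:R / 2 :> R by rewrite divr_ge0.
have s0 : 0 <= p%:R / 2 + 2 * e by rewrite addr_ge0// mulr_ge0// ltW.
apply: (@le_trans _ _ (\int[lebRn R p]_x
    ((K `^ (p%:R / 2 + 2))%:E * ((1 + norm1 x) `^ (- p%:R - 4 * e))%:E))%E).
  apply: ge0_le_integral => //.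
  - by move=> x _; rewrite lee_fin powR_ge0.
  - by apply/measurable_EFinP; exact: measurable_weight.
  - apply: measurable_funeM; apply/measurable_EFinP; apply: measurable_funpowR.
    by apply: measurable_funD => //; exact: measurable_norm1.
  - move=> x _; rewrite -EFinM lee_fin.
    have n0 := norm1_ge0 x; have w0 := sqnorm_ge0 x.
    rewrite -opprD (_ : - p%:R - 4 * e =
      (- (p%:R / 2 + 2 * e)) + (- (p%:R / 2 + 2 * e))); last by field.
    rewrite [X in _ <= _ * X]powRD; last by apply/implyP => _;
      rewrite gt_eqF// ltr_pwDl.
    rewrite -powRM ?addr_ge0// -expr2.
    have KK : K `^ (p%:R / 2 + 2 * e) <= K `^ (p%:R / 2 + 2).
      by apply: ler_powR => //; lra.
    apply: (le_trans _ (ler_wpM2r (powR_ge0 _ _) KK)).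
    have -> : K `^ (p%:R / 2 + 2 * e) = K^-1 `^ (- (p%:R / 2 + 2 * e)).
      by rewrite -[K^-1]powR_inv1 ?(le_trans _ K1)// -powRrM mulrN mulNr opprK
        mul1r.
    rewrite -powRM ?sqr_ge0 ?invr_ge0 ?(le_trans _ K1)//.
    apply: le_powRN => //.
      by rewrite mulr_gt0 ?invr_gt0 ?(lt_le_trans _ K1)// exprn_gt0// ltr_pwDl.
    by rewrite mulrC ler_pdivrMr ?(lt_le_trans _ K1)// mulrC;
      exact: sqnorm_norm1.
rewrite ge0_integralZl//; last 3 first.
- apply/measurable_EFinP; apply: measurable_funpowR.
  by apply: measurable_funD => //; exact: measurable_norm1.
- by move=> x _; rewrite lee_fin powR_ge0.
- by rewrite lee_fin powR_ge0.
rewrite integral_powR_norm1// ?mulr_gt0// powR1 mulr1 -EFinM lee_fin -mulrA.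
apply: ler_wpM2l; first exact: powR_ge0.
case: p p0 {K K1 p0' s0} => // p _.
rewrite big_ord_recl/= add0r exprS mulrC mulrAC [leRHS]mulrC.
apply: ler_pM.
- by apply: prodr_ge0 => i _; rewrite divr_ge0// addr_ge0// mulr_ge0// ltW.
- by rewrite divr_ge0// mulr_ge0// ltW.
- rewrite -[X in _ ^+ X]card_ord -prodr_const; apply: ler_prod => i _.
  apply/andP; split; first by rewrite divr_ge0// addr_ge0// mulr_ge0// ltW.
  rewrite ler_pdivrMr; last by rewrite ltr_pwDl// mulr_ge0// ltW.
  rewrite /bump leq0n add1n -[i.+1%:R]natr1; have : 0 <= i%:R :> R by [].
  by lra.
- by rewrite ler_pM2l// lef_pV2 ?posrE// ?mulr_gt0//; lra.
Qed.

End weights.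

Lemma measurable_funV d (T : measurableType d) (R : realType) (f : T -> R) :
  measurable_fun [set: T] f -> (forall x, 0 <= f x) ->
  measurable_fun [set: T] (fun x => (f x)^-1).
Proof.
move=> mf f0; rewrite (_ : (fun _ => _) = (fun x => f x `^ (- 1))).
  exact: measurable_funpowR.
by apply/funext => x; rewrite powR_inv1.
Qed.

Section prior_weight.
Context {R : realType}.

Lemma weight_powRD (n : nat) (x : n.-tuple R) (c d : R) :
  (1 + sqnorm x) `^ c * (1 + sqnorm x) `^ d = (1 + sqnorm x) `^ (c + d).
Proof.
by rewrite powRD//; apply/implyP => _; rewrite gt_eqF// ltr_pwDl// sqnorm_ge0.
Qed.

Lemma le_weight (n : nat) (x : n.-tuple R) (c d : R) : c <= d ->
  (1 + sqnorm x) `^ c <= (1 + sqnorm x) `^ d.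
Proof. by move=> cd; apply: ler_powR => //; rewrite lerDl sqnorm_ge0. Qed.

Lemma prior_dens_le_weight (n : nat) (x : n.-tuple R) (a b : R) : 0 < a ->
  0 < b ->
  prior_dens a b x <= Num.min a 1 `^ (- b) * (1 + sqnorm x) `^ (- b).
Proof.
move=> a0 b0; have w0 := sqnorm_ge0 x.
have m0 : 0 < Num.min a 1 by rewrite lt_min a0/=.
rewrite -powRM ?addr_ge0 ?(ltW m0)//; apply: le_powRN; last exact: ltW.
  by rewrite mulr_gt0// ltr_pwDl.
rewrite mulrDr mulr1 lerD ?ge_min ?lexx//.
by rewrite ler_piMl// ge_min lexx orbT.
Qed.

(* For [a = 0] the prior is singular at the origin; there it is dominated by a
   product of one-dimensional densities [|y| `^ (- q)], with
     [q = 2 * b / p < 1],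
   regularized by [m] since [0 `^ (- q) = 0] is not an upper bound at [y = 0].
     *)
Definition local_dens (m q y : R) : R :=
  8 * (((m + `|y|) / (1 + `|y|)) `^ (- q) * (1 + `|y|) ^- 2).

Lemma measurable_local_dens0 (m q : R) : measurable_fun [set: R]
  (fun y => ((m + `|y|) / (1 + `|y|)) `^ (- q) * (1 + `|y|) ^- 2).
Proof.
have mD c : measurable_fun [set: R] (fun y : R => c + `|y|).
  by apply: measurable_funD => //; exact: measurableT_comp.
apply: measurable_funM.
  apply: measurable_funpowR; apply: measurable_funM => //.
  by apply: measurable_funV => // y; rewrite addr_ge0.
apply: measurable_funV => [|y]; first exact: measurable_funX.
by rewrite exprn_ge0// addr_ge0.
Qed.

Lemma measurable_local_dens (m q : R) : measurable_fun [set: R]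
  (local_dens m q).
Proof. by apply: measurable_funM => //; exact: measurable_local_dens0. Qed.

Lemma local_dens_ge0 (m q y : R) : 0 <= local_dens m q y.
Proof.
by rewrite mulr_ge0// mulr_ge0 ?powR_ge0// invr_ge0 exprn_ge0// addr_ge0.
Qed.

(** The 8 in [local_dens] is 2 * 4: the quotient is at most 2s, the power -q with q <= 1 then loses
    at most a factor 2, and (1 + |y|)^(-2) is at least 1/4. *)
Lemma le_local_dens (m q s y : R) : 0 < m -> m <= s -> s <= 1 -> `|y| <= s ->
  0 <= q -> q <= 1 -> s `^ (- q) <= local_dens m q y.
Proof.
move=> m0 ms s1 ys q0 q1; have y0 := normr_ge0 y.
have s0 : 0 < s by lra.
have d0 : 0 < 1 + `|y| by lra.
have H1 : (2 * s) `^ (- q) <= ((m + `|y|) / (1 + `|y|)) `^ (- q).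
  apply: le_powRN => //; first by rewrite divr_gt0//; lra.
  by rewrite ler_pdivrMr//; nra.
have H2 : 4^-1 <= (1 + `|y|) ^- 2.
  by rewrite lef_pV2 ?posrE ?exprn_gt0//; nra.
have H3 : 2^-1 * s `^ (- q) <= (2 * s) `^ (- q).
  rewrite powRM ?(ltW s0)//; apply: ler_wpM2r; first exact: powR_ge0.
  by rewrite powRN lef_pV2 ?posrE ?powR_gt0// ler1_powR//; lra.
have H4 := powR_ge0 s (- q).
have H5 : 4^-1 * (2^-1 * s `^ (- q)) <=
  ((m + `|y|) / (1 + `|y|)) `^ (- q) * (1 + `|y|) ^- 2.
  by rewrite mulrC; apply: ler_pM => //; [lra|exact: le_trans H1].
by rewrite /local_dens; lra.
Qed.

(** The unit sphere separates two regimes. Outside, |x|^2 >= (1 + |x|^2) / 2 costs the factor 2^b.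
    Inside, |x|^(-2b) is a product of [n] equal factors |x|^(-2b/n), each below the local density
    because every coordinate is at most |x|. At the origin no lower bound by [m] is asked for, as
    [powR] makes the prior density 0 there. *)
Lemma prior0_weight_le (n : nat) (x : n.-tuple R) (b c m : R) : (0 < n)%N ->
  0 < b -> b <= n%:R / 2 -> c <= 0 -> 0 < m -> sqnorm x = 0 \/ m <=
    Num.sqrt (sqnorm x) ->
  prior_dens 0 b x * (1 + sqnorm x) `^ c <=
  2 `^ b * (1 + sqnorm x) `^ (- b + c) +
  \prod_(i < n) local_dens m (2 * b / n%:R) (tnth x i).
Proof.
move=> n0 b0 bn c0 m0; have w0 := sqnorm_ge0 x.
have P0 : 0 <= \prod_(i < n) local_dens m (2 * b / n%:R) (tnth x i).
  by apply: prodr_ge0 => i _; exact: local_dens_ge0.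
have Q0 (d : R) : 0 <= 2 `^ b * (1 + sqnorm x) `^ d by rewrite mulr_ge0
  ?powR_ge0.
rewrite /prior_dens add0r => wm.
have [w00|wpos] := eqVneq (sqnorm x) 0.
  by rewrite {1}w00 powR0 ?mul0r ?addr_ge0// oppr_eq0 gt_eqF.
have {wpos}wpos : 0 < sqnorm x by rewrite lt_neqAle eq_sym wpos.
have {wm}ms : m <= Num.sqrt (sqnorm x) by case: wm => // w0'; move: wpos;
  rewrite w0' ltxx.
have [w1|w1] := leP 1 (sqnorm x).
  apply: (@le_trans _ _ (2 `^ b * (1 + sqnorm x) `^ (- b + c)));
    last by rewrite lerDl.
  rewrite -weight_powRD mulrA; apply: ler_wpM2r; first exact: powR_ge0.
  have -> : 2 `^ b = 2^-1 `^ (- b) by rewrite -[2^-1]powR_inv1// -powRrM mulrN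
    mulNr opprK mul1r.
  rewrite -powRM ?addr_ge0//; apply: le_powRN; last exact: ltW.
    by rewrite mulr_gt0// ltr_pwDl.
  by lra.
apply: (@le_trans _ _ (\prod_(i < n) local_dens m (2 * b / n%:R) (tnth x i)));
  last by rewrite lerDr.
apply: (@le_trans _ _ (sqnorm x `^ (- b))).
  rewrite -[leRHS]mulr1; apply: ler_wpM2l; first exact: powR_ge0.
  by rewrite -[leRHS](powRr0 (1 + sqnorm x)); exact: le_weight.
set s := Num.sqrt (sqnorm x).
have s0 : 0 < s by rewrite sqrtr_gt0.
have nR : 0 < n%:R :> R by rewrite ltr0n.
have -> : sqnorm x `^ (- b) = \prod_(i < n) (s `^ (- (2 * b / n%:R))).
  rewrite prodr_const card_ord -powR_mulrn ?powR_ge0// -powRrM.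
  rewrite /s -powR12_sqrt// -powRrM; congr (_ `^ _).
  by field; rewrite gt_eqF.
apply: ler_prod => i _; rewrite powR_ge0/=; apply: le_local_dens => //.
- by rewrite -sqrtr1 ler_wsqrtr// ltW.
- exact: le_sqrt_sqnorm.
- by rewrite divr_ge0// mulr_ge0// ltW.
- by rewrite ler_pdivrMr// mul1r; lra.
Qed.

(** The rest of the proof uses [a] and [b] only through this bound. The lower bound on [b] brings
    the exponent -b - 1 - 2e below -p/2 - 2e, which settles infinity. The alternative on [a] settles
    the origin: if a = 0, then b < p/2 gives q < 1. *)
Lemma integral_prior_weight_le (p : nat) (a b : R) : (0 < p)%N -> 0 <= a ->
  0 < b ->
  p%:R / 2 - 1 <= b -> 0 < a \/ a = 0 /\ b < p%:R / 2 ->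
  exists2 C : R, 0 <= C & forall e : R, 0 < e -> e <= 1 ->
  (\int[lebRn R p]_x (prior_dens a b x * (1 + sqnorm x) `^ (- 1 - 2 * e))%:E
    <= (C / e)%:E)%E.
Proof.
move=> p0 _ b0 pb ab; have [C C0 HC] := @integral_weight_le R p p0.
have mf (c : R) : measurable_fun [set: p.-tuple R]
    (fun x => (prior_dens a b x * (1 + sqnorm x) `^ c)%:E).
  apply/measurable_EFinP; apply: measurable_funM.
    exact: measurable_prior_dens.
  exact: measurable_weight.
have mg (c d : R) : measurable_fun [set: p.-tuple R]
    (fun x => (c%:E * ((1 + sqnorm x) `^ d)%:E)%E).
  by apply: measurable_funeM; apply/measurable_EFinP; exact: measurable_weight.
have f0 (c : R) x : (0 <= (prior_dens a b x * (1 + sqnorm x) `^ c)%:E)%E.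
  by rewrite lee_fin mulr_ge0 ?powR_ge0.
have intg (k e : R) : 0 <= k -> 0 < e -> e <= 1 ->
    (\int[lebRn R p]_x (k%:E * ((1 + sqnorm x) `^ (- (p%:R / 2) - 2 * e))%:E) <=
      (k * C / e)%:E)%E.
  move=> k0 e0 e1; rewrite ge0_integralZl//; last 2 first.
  - by apply/measurable_EFinP; exact: measurable_weight.
  - by move=> x _; rewrite lee_fin powR_ge0.
  by rewrite -mulrA EFinM; apply: lee_wpmul2l; [rewrite lee_fin|exact: HC].
have [a0|[a0 bp]] := ab.
  exists (Num.min a 1 `^ (- b) * C); first by rewrite mulr_ge0 ?powR_ge0.
  move=> e e0 e1; apply: (le_trans _ (intg _ _ (powR_ge0 _ _) e0 e1)).
  apply: ge0_le_integral => //.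
  move=> x _; rewrite -EFinM lee_fin.
  apply: (@le_trans _ _ (Num.min a 1 `^ (- b) * (1 + sqnorm x) `^ (- b) *
    (1 + sqnorm x) `^ (- 1 - 2 * e))).
    by apply: ler_wpM2r; [exact: powR_ge0|exact: prior_dens_le_weight].
  rewrite -mulrA weight_powRD; apply: ler_wpM2l; first exact: powR_ge0.
  by apply: le_weight; lra.
rewrite a0 in mf f0 *.
pose q := 2 * b / p%:R.
have pR : 0 < p%:R :> R by rewrite ltr0n.
have q1 : q < 1 by rewrite /q ltr_pdivrMr// mul1r; lra.
pose K := (8 * (4 / (1 - q))) ^+ p.
have K0 : 0 <= K by rewrite exprn_ge0// mulr_ge0// divr_ge0//; lra.
exists (2 `^ b * C + K); first by rewrite addr_ge0 ?mulr_ge0 ?powR_ge0.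
move=> e e0 e1.
(* The sequence starts at 1/2, as [integral_powR_norm_local] requires, and falls below |x| from some
   rank on for each nonzero [x]. *)
pose m (n : nat) : R := (n.+2%:R)^-1.
have m0 n : 0 < m n by rewrite invr_gt0.
have mprod n : measurable_fun [set: p.-tuple R]
    (fun x => (\prod_(i < p) local_dens (m n) q (tnth x i))%:E).
  apply/measurable_EFinP; apply: measurable_prod => i _.
  by apply: measurableT_comp; [exact: measurable_local_dens|exact:
    measurable_tnth].
have prod0 n (x : p.-tuple R) : (0 <= (\prod_(i < p) local_dens (m n) q
  (tnth x i))%:E)%E.
  by rewrite lee_fin prodr_ge0// => i _; exact: local_dens_ge0.
have g0 (c d : R) (x : p.-tuple R) : 0 <= c ->
  (0 <= c%:E * ((1 + sqnorm x) `^ d)%:E)%E.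
  by move=> c0; rewrite mule_ge0// lee_fin ?powR_ge0.
apply: (@le_integral_eventually _ _ _ _ _ (fun n x =>
  ((2 `^ b)%:E * ((1 + sqnorm x) `^ (- (p%:R / 2) - 2 * e))%:E +
   (\prod_(i < p) local_dens (m n) q (tnth x i))%:E)%E)) => //.
- by move=> n; apply: emeasurable_funD.
- by move=> n x; rewrite adde_ge0// g0// powR_ge0.
- move=> x; have w0 := sqnorm_ge0 x.
  have [N NP] : exists N, sqnorm x = 0 \/ m N <= Num.sqrt (sqnorm x).
    have [->|wpos] := eqVneq (sqnorm x) 0; first by exists 0%N; left.
    exists (Num.bound (Num.sqrt (sqnorm x))^-1); right.
    have s0 : 0 < Num.sqrt (sqnorm x) by rewrite sqrtr_gt0 lt_neqAle eq_sym
      wpos.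
    rewrite /m -[leRHS]invrK lef_pV2 ?posrE ?invr_gt0//.
    have := archi_boundP (ltW (etrans (invr_gt0 _) s0)).
    move=> /ltW/le_trans; apply; rewrite ler_nat.
    by rewrite (leq_trans (leqnSn _))// leqnSn.
  exists N => n Nn; rewrite -EFinM -EFinD lee_fin.
  have mNn : m n <= m N by rewrite lef_pV2 ?posrE// ler_nat !ltnS.
  apply: (le_trans (@prior0_weight_le p x b (- 1 - 2 * e) (m n) _ _ _ _ _ _)) =>
    //.
  + by lra.
  + by lra.
  + by case: NP => [->|NP]; [left|right; exact: le_trans NP].
  + rewrite lerD2r; apply: ler_wpM2l; first exact: powR_ge0.
    by apply: le_weight; lra.
- move=> n; rewrite ge0_integralD//; last by move=> x _; rewrite g0// powR_ge0.
  rewrite [(_ + K) / e]mulrDl EFinD; apply: leeD; first by apply: intg => //;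
    exact: powR_ge0.
  (* The contribution of the origin is at most [K] for every [e], hence at most K / e as
     [e <= 1]. *)
  apply: (@le_trans _ _ K%:E); last first.
    by rewrite lee_fin ler_pdivlMr// ler_piMr.
  apply: (@le_integral_prod R p (fun=> local_dens (m n) q) (8 * (4 / (1 - q))))
    => //.
  + by rewrite mulr_ge0// divr_ge0//; lra.
  + by move=> i; exact: measurable_local_dens.
  + by move=> i x; exact: local_dens_ge0.
  + move=> i; rewrite /local_dens; under eq_integral do rewrite EFinM.
    rewrite ge0_integralZl//; last 2 first.
    * by apply/measurable_EFinP; exact: measurable_local_dens0.
    * by move=> x _; rewrite lee_fin mulr_ge0 ?powR_ge0// invr_ge0 exprn_ge0//
        addr_ge0.
    rewrite EFinM; apply: lee_wpmul2l; first by rewrite lee_fin.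
    apply: integral_powR_norm_local => //.
    by rewrite lef_pV2 ?posrE// ler_nat.
Qed.

End prior_weight.

(** * Gaussian moments *)

Section gauss.
Context {R : realType}.
Local Notation mu := (@lebesgue_measure R).

Lemma sqdist_ge0 (n : nat) (x y : n.-tuple R) : 0 <= sqdist x y.
Proof. by apply: sumr_ge0 => i _; exact: sqr_ge0. Qed.

Lemma normal_dens_gt0 (n : nat) (th x : n.-tuple R) : 0 < normal_dens th x.
Proof. by rewrite mulr_gt0 ?expR_gt0// powR_gt0// mulr_gt0// pi_gt0. Qed.

Lemma normal_dens_ge0 (n : nat) (th x : n.-tuple R) : 0 <= normal_dens th x.
Proof. exact/ltW/normal_dens_gt0. Qed.

Lemma measurable_fun_sqdist d (T : measurableType d) (n : nat)
  (f g : T -> n.-tuple R) :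
  measurable_fun [set: T] f -> measurable_fun [set: T] g ->
  measurable_fun [set: T] (fun z => sqdist (f z) (g z)).
Proof.
move=> mf mg; apply: measurable_sum => i; apply: measurable_funX.
apply: measurable_funB.
  exact: (measurableT_comp (measurable_tnth i) mf).
exact: (measurableT_comp (measurable_tnth i) mg).
Qed.

Lemma measurable_fun_normal_dens d (T : measurableType d) (n : nat)
  (f g : T -> n.-tuple R) :
  measurable_fun [set: T] f -> measurable_fun [set: T] g ->
  measurable_fun [set: T] (fun z => normal_dens (f z) (g z)).
Proof.
move=> mf mg; apply: measurable_funM => //.
apply: measurableT_comp => //; apply: measurableT_comp => //.
by apply: measurable_funM => //; exact: measurable_fun_sqdist.
Qed.

Lemma integral_gauss (m : R) :
  (\int[mu]_x (expR (- ((x - m) ^+ 2 / 4)))%:E =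
    (normal_peak (Num.sqrt (2 : R)))^-1%:E)%E.
Proof.
have s0 : Num.sqrt (2 : R) != 0 by rewrite gt_eqF// sqrtr_gt0.
have pk := normal_peak_gt0 s0.
under eq_integral => x _.
  rewrite (_ : expR _ = (normal_peak (Num.sqrt (2 : R)))^-1 * normal_pdf m
    (Num.sqrt 2) x); last first.
    rewrite normal_pdfE// mulrA mulVf ?gt_eqF// mul1r /normal_fun sqr_sqrtr//.
    by congr expR; rewrite mulNr -mulr_natr; congr (- (_ / _)); ring.
  rewrite EFinM.
  over.
rewrite ge0_integralZl//; last 3 first.
- by apply/measurable_EFinP; exact: measurable_normal_pdf.
- by move=> x _; rewrite lee_fin normal_pdf_ge0.
- by rewrite lee_fin invr_ge0 ltW.
by rewrite integral_normal_pdf mule1.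
Qed.

(** Half of the exponent absorbs the polynomial: the term of index [k.+1] of the exponential series
    at (1 + s) / 4 bounds the power. What is left is the Gaussian of variance 2 evaluated in
    [integral_gauss]. *)
Lemma expr_expRN_le (k : nat) (s : R) : 0 <= s ->
  (1 + s) ^+ k * expR (- (s / 2)) <= 4 ^+ k.+1 * k.+1`!%:R * expR 4^-1 * expR
    (- (s / 4)).
Proof.
move=> s0.
have u0 : 0 <= (1 + s) / 4 by lra.
have H1 : (1 + s) ^+ k <= (1 + s) ^+ k.+1 by rewrite ler_weXn2l//; lra.
have H2 : ((1 + s) / 4) ^+ k.+1 / k.+1`!%:R <= expR ((1 + s) / 4).
  by have := expR_ge1Dxn k u0; lra.
have f0 : 0 < k.+1`!%:R :> R by rewrite ltr0n fact_gt0.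
have H3 : (1 + s) ^+ k <= 4 ^+ k.+1 * k.+1`!%:R * expR ((1 + s) / 4).
  apply: (le_trans H1); move: H2; rewrite ler_pdivrMr// => H2.
  rewrite -mulrA [_ * expR _]mulrC -ler_pdivrMl ?exprn_gt0//.
  by apply: le_trans H2; rewrite expr_div_n mulrC.
apply: (le_trans (ler_wpM2r (expR_ge0 _) H3)).
rewrite -!mulrA -!expRD; apply: ler_wpM2l; first by rewrite exprn_ge0.
apply: ler_wpM2l; first exact: ltW.
by rewrite ler_expR; lra.
Qed.

Lemma normal_dens_decay (n k : nat) : exists2 K : R, 0 <=
  K & forall th x : n.-tuple R,
  normal_dens th x * (1 + sqdist x th) ^+ k <= K * expR (- (sqdist x th / 4)).
Proof.
pose c : R := (2 * pi) `^ (- (n%:R / 2)).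
have c0 : 0 <= c by exact: powR_ge0.
exists (c * (4 ^+ k.+1 * k.+1`!%:R * expR 4^-1)).
  by rewrite mulr_ge0// mulr_ge0 ?expR_ge0// mulr_ge0// exprn_ge0.
move=> th x; rewrite /normal_dens -/c -mulrA -[leRHS]mulrA; apply: ler_wpM2l =>
  //.
by rewrite mulrC; exact: expr_expRN_le (sqdist_ge0 _ _).
Qed.

(** Uniform in [th] because the remaining Gaussian factors over the coordinates and each
    one-dimensional integral is translation invariant. *)
Lemma integral_normal_moment (n k : nat) : exists2 C : R, 0 <= C &
  forall th : n.-tuple R,
  (\int[lebRn R n]_x (normal_dens th x * (1 + sqdist x th) ^+ k)%:E <= C%:E)%E.
Proof.
have [K K0 HK] := normal_dens_decay n k.
have pk : 0 <= (normal_peak (Num.sqrt (2 : R)))^-1 by rewrite invr_ge0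
  normal_peak_ge0.
exists (K * (normal_peak (Num.sqrt (2 : R)))^-1 ^+ n);
  first by rewrite mulr_ge0// exprn_ge0.
move=> th.
have mg (c : R) : measurable_fun [set: R]
  (fun y => expR (- ((y - c) ^+ 2 / 4))).
  apply: measurableT_comp => //; apply: measurableT_comp => //.
  apply: measurable_funM => //; apply: measurable_funX.
  exact: measurable_funB.
have mp : measurable_fun [set: n.-tuple R] (fun x =>
    (\prod_(i < n) expR (- ((tnth x i - tnth th i) ^+ 2 / 4)))%:E).
  apply/measurable_EFinP; apply: measurable_prod => i _.
  exact: (measurableT_comp (mg (tnth th i)) (measurable_tnth i)).
have p0 (x : n.-tuple R) : (0 <= (\prod_(i < n) expR
  (- ((tnth x i - tnth th i) ^+ 2 / 4)))%:E)%E.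
  by rewrite lee_fin prodr_ge0// => i _; exact: expR_ge0.
apply: (@le_trans _ _ (\int[lebRn R n]_x (K%:E *
   (\prod_(i < n) expR (- ((tnth x i - tnth th i) ^+ 2 / 4)))%:E))%E).
  apply: ge0_le_integral => //.
  - by move=> x _; rewrite lee_fin mulr_ge0 ?normal_dens_ge0// exprn_ge0//
      addr_ge0// sqdist_ge0.
  - apply/measurable_EFinP; apply: measurable_funM;
      first exact: measurable_fun_normal_dens.
    apply: measurable_funX; apply: measurable_funD => //.
    exact: measurable_fun_sqdist.
  - exact: measurable_funeM.
  - move=> x _; rewrite -EFinM lee_fin (le_trans (HK th x))//.
    apply: ler_wpM2l => //; rewrite -expR_sum ler_expR.
    by rewrite sumrN lerN2 mulr_suml.
rewrite ge0_integralZl// EFinM; apply: lee_wpmul2l; first by rewrite lee_fin.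
apply: (@le_integral_prod R n (fun i y => expR (- ((y - tnth th i) ^+ 2 / 4))))
  => //.
- by move=> i; rewrite integral_gauss.
Qed.

End gauss.

(** * The cutoff functions *)

Section cutoff.
Context {R : realType}.

Lemma peetre (n : nat) (x y : n.-tuple R) :
  1 + sqnorm x <= 2 * (1 + sqnorm y) * (1 + sqdist x y).
Proof.
have : sqnorm x <= 2 * sqnorm y + 2 * sqdist x y.
  rewrite /sqnorm /sqdist !mulr_sumr -big_split/=; apply: ler_sum => i _.
  (* For the coordinates u of [x] and v of [y], 2 v^2 + 2 (u - v)^2 - u^2 = (u - 2 v)^2. *)
  by have := sqr_ge0 (tnth x i - 2 * tnth y i); nra.
by have := sqnorm_ge0 y; have := sqdist_ge0 x y; nra.
Qed.

Lemma sqdistC (n : nat) (x y : n.-tuple R) : sqdist x y = sqdist y x.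
Proof. by apply: eq_bigr => i _; rewrite -sqrrN opprB. Qed.

(** A weighted AM-GM in each coordinate stands in for Cauchy-Schwarz: with [r] the square root of 1
    + |x|^2, the cross term 2 |(u - v) u| is at most r (u - v)^2 + u^2 / r. This weight is balanced,
    since |x|^2 / r <= r after summation. *)
Lemma sqnormB_le (n : nat) (x y : n.-tuple R) :
  (sqnorm x - sqnorm y) ^+ 2 <= 4 * (1 + sqnorm x) * (1 + sqdist x y) ^+ 2.
Proof.
set A := 1 + sqnorm x; set D := 1 + sqdist x y.
have A1 : 1 <= A by rewrite lerDl sqnorm_ge0.
set r := Num.sqrt A.
have r1 : 1 <= r by rewrite -sqrtr1 ler_wsqrtr.
have rE : r ^+ 2 = A by rewrite sqr_sqrtr// (le_trans _ A1).
have s0 := sqdist_ge0 x y.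
have B : `|sqnorm x - sqnorm y| <= 2 * r * D.
  apply: (@le_trans _ _ (r * sqdist x y + r^-1 * sqnorm x + sqdist x y)).
    rewrite -sumrB /sqnorm /sqdist !mulr_sumr -!big_split/=.
    apply: (le_trans (ler_norm_sum _ _ _)); apply: ler_sum => i _.
    set u := tnth x i; set v := tnth y i.
    have -> : u ^+ 2 - v ^+ 2 = 2 * ((u - v) * u) - (u - v) ^+ 2 by ring.
    have H : r * (u - v) ^+ 2 + r^-1 * u ^+ 2 - 2 * ((u - v) * u) =
        r^-1 * (r * (u - v) - u) ^+ 2 by field; lra.
    have H' : r * (u - v) ^+ 2 + r^-1 * u ^+ 2 + 2 * ((u - v) * u) =
        r^-1 * (r * (u - v) + u) ^+ 2 by field; lra.
    have i0 : 0 <= r^-1 by rewrite invr_ge0; lra.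
    have := mulr_ge0 i0 (sqr_ge0 (r * (u - v) - u)).
    have := mulr_ge0 i0 (sqr_ge0 (r * (u - v) + u)).
    rewrite -H -H' ler_norml => K1 K2.
    have := sqr_ge0 (u - v); lra.
  have : r^-1 * sqnorm x <= r.
    rewrite ler_pdivrMl; last lra.
    by rewrite -expr2 rE lerDr.
  by rewrite /D; nra.
rewrite -real_normK ?num_real//; apply: (le_trans (lerXn2r _ _ _ B)).
- by rewrite nnegrE.
- by rewrite nnegrE; apply: le_trans B.
- by rewrite !exprMn rE; lra.
Qed.

(** Convexity of the power -e: its graph lies above the tangent at [A]. After division by the value
    at [A] this follows from exp s >= 1 + s and ln s <= s - 1. *)
Lemma powRN_tangent (A B e : R) : 0 < A -> 0 < B -> 0 <= e ->
  A `^ (- e) - B `^ (- e) <= e * A `^ (- e - 1) * (B - A).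
Proof.
move=> A0 B0 e0.
have BA : 0 < B / A by rewrite divr_gt0.
have -> : A `^ (- e - 1) = A `^ (- e) / A.
  by rewrite powRB ?powRr1 ?(ltW A0)//; apply/implyP => _; rewrite gt_eqF.
have -> : B `^ (- e) = A `^ (- e) * expR (- e * ln (B / A)).
  rewrite -[X in _ * X](_ : (B / A) `^ (- e) = _); last by rewrite /powR gt_eqF.
  by rewrite -powRM ?(ltW A0) ?(ltW BA)// mulrC divfK// gt_eqF.
have H1 := expR_ge1Dx (- e * ln (B / A)).
have H2 : ln (B / A) <= B / A - 1.
  have := expR_ge1Dx (ln (B / A)); rewrite lnK ?posrE//; lra.
have H3 : e * ln (B / A) <= e * (B / A - 1) by apply: ler_wpM2l.
have P : 0 <= A `^ (- e) by exact: powR_ge0.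
have -> : e * (A `^ (- e) / A) * (B - A) = A `^ (- e) * (e * (B / A - 1)).
  by field; rewrite gt_eqF.
by rewrite -[X in X - _]mulr1 -mulrBr; apply: ler_wpM2l => //; lra.
Qed.

(** Write A, B, D for 1 + |x|^2, 1 + |y|^2, 1 + |x - y|^2. The slope at A is of size e A^(-e-1),
    while A - B is of order sqrt A times D: hence the decay A^(-1-2e). If B < A, the tangent is
    taken at B, and Peetre's inequality A <= 2BD moves it to A at the price (2D)^(1+e) <= 4 D^2.
    Squared, this gives 16 D^4, and the 4 D^2 of [sqnormB_le] makes it 64 D^6. *)
Lemma powRN_sqrB_le (n : nat) (x y : n.-tuple R) (e : R) : 0 < e -> e <= 1 ->
  ((1 + sqnorm x) `^ (- e) - (1 + sqnorm y) `^ (- e)) ^+ 2 <=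
  64 * e ^+ 2 * (1 + sqdist x y) ^+ 6 * (1 + sqnorm x) `^ (- 1 - 2 * e).
Proof.
move=> e0 e1.
have x0 := sqnorm_ge0 x; have y0 := sqnorm_ge0 y; have s0 := sqdist_ge0 x y.
have P1 := peetre x y; have S := sqnormB_le x y.
set A := 1 + sqnorm x in P1 S *; set B := 1 + sqnorm y in P1 *.
set D := 1 + sqdist x y in P1 S *.
have A1 : 1 <= A by rewrite lerDl.
have B1 : 1 <= B by rewrite lerDl.
have D1 : 1 <= D by rewrite lerDl.
have A0 : 0 < A by lra.
have B0 : 0 < B by lra.
have SAB : (A - B) ^+ 2 <= 4 * A * D ^+ 2.
  by rewrite (_ : A - B = sqnorm x - sqnorm y)// /A /B; ring.
set c := e * A `^ (- e - 1).
have c0 : 0 <= c by rewrite mulr_ge0 ?powR_ge0 ?ltW.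
have D2 : 1 <= 4 * D ^+ 2 by nra.
have HN : `|A `^ (- e) - B `^ (- e)| <= 4 * D ^+ 2 * c * `|A - B|.
  rewrite ler_norml; apply/andP; split.
    rewrite lerNl opprB.
    have T := powRN_tangent B0 A0 (ltW e0).
    have [AB|BA] := leP A B.
      apply: (@le_trans _ _ 0); last by rewrite mulr_ge0// mulr_ge0//; lra.
      by rewrite subr_le0; apply: le_powRN => //; exact: ltW.
    apply: (le_trans T); rewrite ger0_norm ?subr_ge0 ?(ltW BA)//.
    apply: ler_wpM2r; first by rewrite subr_ge0 ltW.
    have -> : 4 * D ^+ 2 * c = e * (4 * D ^+ 2 * A `^ (- e - 1)) by rewrite /c;
      ring.
    apply: ler_wpM2l; first exact: ltW.
    apply: (@le_trans _ _ ((A / (2 * D)) `^ (- e - 1))).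
      rewrite -opprD; apply: le_powRN.
      - by rewrite divr_gt0//; lra.
      - by rewrite ler_pdivrMr; lra.
      - by lra.
    rewrite powRM ?(ltW A0) ?invr_ge0; [|by []|by lra].
    rewrite mulrC; apply: ler_wpM2r; first exact: powR_ge0.
    rewrite -[(2 * D)^-1]powR_inv1; last by lra.
    rewrite -powRrM (_ : -1 * (- e - 1) = 1 + e); last by ring.
    apply: (@le_trans _ _ ((2 * D) `^ 2%:R)); first by apply: ler_powR; lra.
    by rewrite powR_mulrn; [rewrite exprMn; lra|lra].
  apply: (le_trans (powRN_tangent A0 B0 (ltW e0))); rewrite -/c.
  have cAB : c * (B - A) <= c * `|A - B|.
    by apply: ler_wpM2l => //; rewrite distrC ler_norm.
  apply: (le_trans cAB); rewrite -[X in _ <= X]mulrA ler_peMl// mulr_ge0//.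
rewrite -real_normK ?num_real//.
apply: (@le_trans _ _ ((4 * D ^+ 2 * c * `|A - B|) ^+ 2)).
  by rewrite lerXn2r ?nnegrE// mulr_ge0// mulr_ge0//; lra.
rewrite exprMn real_normK ?num_real//.
apply: (@le_trans _ _ ((4 * D ^+ 2 * c) ^+ 2 * (4 * A * D ^+ 2))).
  by apply: ler_wpM2l => //; exact: sqr_ge0.
have cA : c ^+ 2 * A = e ^+ 2 * A `^ (- 1 - 2 * e).
  rewrite exprMn -mulrA; congr (_ * _).
  have -> : A `^ (- e - 1) ^+ 2 * A = A `^ (- e - 1) ^+ 2 * A `^ 1 by rewrite
    powRr1 ?ltW.
  rewrite -powR_mulrn ?powR_ge0// -powRrM -powRD; last by apply/implyP => _;
    rewrite gt_eqF.
  by congr (_ `^ _); ring.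
have -> : (4 * D ^+ 2 * c) ^+ 2 * (4 * A * D ^+ 2) =
  64 * D ^+ 6 * (c ^+ 2 * A) by ring.
by rewrite cA le_eqVlt; apply/orP; left; apply/eqP; ring.
Qed.

(* Compactly supported, and tends to 1 pointwise as [e] tends to 0. *)
Definition cutoff (n : nat) (e : R) (x : n.-tuple R) : R :=
  Num.max 0 ((1 + sqnorm x) `^ (- e) - e).

Lemma measurable_cutoff (n : nat) (e : R) : measurable_fun [set: n.-tuple R]
  (cutoff e).
Proof.
apply: measurable_maxr => //; apply: measurable_funB => //.
exact: measurable_weight.
Qed.

Lemma cutoff_ge0 (n : nat) (e : R) (x : n.-tuple R) : 0 <= cutoff e x.
Proof. by rewrite /cutoff le_max lexx. Qed.

Lemma cutoff_le1 (n : nat) (e : R) (x : n.-tuple R) : 0 <= e -> cutoff e x <= 1.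
Proof.
move=> e0; rewrite /cutoff ge_max ler01/= lerBlDr.
apply: (@le_trans _ _ 1); last by rewrite lerDl.
by rewrite -[leRHS](powRr0 (1 + sqnorm x)); apply: le_weight; rewrite oppr_le0.
Qed.

(** Shifting by [e] and truncating at 0 is a 1-Lipschitz operation on the power. *)
Lemma cutoff_sqrB_le (n : nat) (e : R) (x y : n.-tuple R) : 0 < e -> e <= 1 ->
  (cutoff e x - cutoff e y) ^+ 2 <=
  64 * e ^+ 2 * (1 + sqdist x y) ^+ 6 * (1 + sqnorm x) `^ (- 1 - 2 * e).
Proof.
move=> e0 e1; apply: (le_trans _ (powRN_sqrB_le x y e0 e1)).
rewrite -[leLHS]real_normK ?num_real// -[leRHS]real_normK ?num_real//.
rewrite lerXn2r ?nnegrE// /cutoff.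
set u := (1 + sqnorm x) `^ (- e); set v := (1 + sqnorm y) `^ (- e).
by rewrite /Num.max; case: ltP => h1; case: ltP => h2; rewrite !ler_norml/=;
  case: (ler0P (u - v)) => h3; lra.
Qed.

(** Where the cutoff is nonzero, (1 + |x|^2)^(-e) > e, and raising this to the power (1 + 2e) / e
    bounds the weight from below. The constant explodes as [e] tends to 0, which is harmless: it
    serves only to show that the cutoff prior has finite mass. *)
Lemma cutoff_sqr_le (n : nat) (e : R) (x : n.-tuple R) : 0 < e -> e <= 1 ->
  (cutoff e x) ^+ 2 <= e `^ (- ((1 + 2 * e) / e)) * (1 + sqnorm x) `^
    (- 1 - 2 * e).
Proof.
move=> e0 e1; have x0 := sqnorm_ge0 x.
have A0 : 0 < 1 + sqnorm x by lra.
have [h|h] := leP ((1 + sqnorm x) `^ (- e)) e.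
  rewrite /cutoff max_l; last by rewrite subr_le0.
  by rewrite expr0n/= mulr_ge0 ?powR_ge0.
apply: (@le_trans _ _ 1).
  by rewrite exprn_ile1 ?cutoff_ge0// cutoff_le1// ltW.
have -> : (1 + sqnorm x) `^ (- 1 - 2 * e) =
  ((1 + sqnorm x) `^ (- e)) `^ ((1 + 2 * e) / e).
  by rewrite -powRrM; congr (_ `^ _); field; rewrite gt_eqF.
rewrite powRN mulrC ler_pdivlMr ?powR_gt0// mul1r.
by apply: ge0_ler_powR; rewrite ?nnegrE ?powR_ge0 ?(ltW e0) ?(ltW h)// divr_ge0
  ?(ltW e0)//; lra.
Qed.

(** By exp s >= 1 + s. At a fixed [x] the condition holds for all small [e], and a lower bound by
    1/2 is enough in the limit, at the cost of a factor 4 on squares. *)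
Lemma cutoff_ge_half (n : nat) (e : R) (x : n.-tuple R) : 0 <= e ->
  e * (1 + ln (1 + sqnorm x)) <= 2^-1 -> 2^-1 <= cutoff e x.
Proof.
move=> e0 he; rewrite /cutoff le_max; apply/orP; right.
rewrite /powR gt_eqF ?ltr_pwDl ?sqnorm_ge0//.
have := expR_ge1Dx (- e * ln (1 + sqnorm x)); lra.
Qed.

End cutoff.

(** * Functionals determined by their values on indicators *)

Section functional.
Import HBNNSimple.
Local Open Scope ereal_scope.
Context d (T : measurableType d) (R : realType).

(** The properties shared by both sides of the disintegration identity, which is given on indicators
    only. They suffice to pass through simple functions to increasing limits, without exhibiting
    either side as a measure on the product. *)
Definition integral_like (I : (T -> \bar R) -> \bar R) : Prop :=
  [/\ forall f g, measurable_fun [set: T] f -> measurable_fun [set: T] g ->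
        (forall x, 0 <= f x) -> (forall x, 0 <= g x) ->
        I (fun x => f x + g x) = I f + I g,
      forall (k : R) f, (0 <= k)%R -> measurable_fun [set: T] f ->
        (forall x, 0 <= f x) -> I (fun x => k%:E * f x) = k%:E * I f &
      forall (f_ : nat -> T -> \bar R) f,
        (forall n, measurable_fun [set: T] (f_ n)) ->
        (forall n x, 0 <= f_ n x) ->
        (forall x, nondecreasing_seq (f_ ^~ x)) ->
        (forall x, f_ n x @[n --> \oo] --> f x) ->
        I (f_ n) @[n --> \oo] --> I f].

Lemma integral_like_nnsfun (I : (T -> \bar R) -> \bar R) (h : {nnsfun T >-> R})
  :
  integral_like I ->
  I (EFin \o h) = \sum_(y <- fset_set (range h))
    (y%:E * I (fun x => (\1_(h @^-1` [set y]) x)%:E)).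
Proof.
move=> [ID IZ _].
have I0 : I (fun=> 0) = 0.
  rewrite (_ : (fun=> 0) = (fun x => 0%:E * (cst 0 x : \bar R))); last first.
    by apply/funext => x; rewrite mul0e.
  by rewrite IZ// mul0e.
have -> : EFin \o h = fun x => \sum_(y <- fset_set (range h))
    (y%:E * (\1_(h @^-1` [set y]) x)%:E).
  apply/funext => x /=; rewrite [in LHS](fimfunE h x) fsbig_finite//=.
  by rewrite -sumEFin; apply: eq_bigr => y _; rewrite EFinM.
have : forall y, y \in enum_fset (fset_set (range h)) -> (0 <= y)%R.
  move=> y; rewrite -[_ \in _]/(y \in fset_set (range h)).
  by rewrite in_fset_set// => /set_mem[x _ <-].
have mi y : measurable_fun [set: T] (fun x => (\1_(h @^-1` [set y]) x)%:E).
  exact/measurable_EFinP/measurable_indic.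
elim: (enum_fset (fset_set (range h))) => [|y s IH] s0.
  by rewrite big_nil -[RHS]I0; congr I; apply/funext => x; rewrite big_nil.
rewrite big_cons -IH; last by move=> z zs; apply: s0; rewrite in_cons zs orbT.
have y0 : (0 <= y)%R by apply: s0; rewrite mem_head.
rewrite -IZ; [|exact: y0|exact: mi|by move=> x; rewrite lee_fin].
rewrite -ID.
- by congr I; apply/funext => x; rewrite big_cons.
- exact: measurable_funeM.
- apply: emeasurable_sum => z; exact: measurable_funeM.
- by move=> x; rewrite mule_ge0// lee_fin.
- move=> x; rewrite big_seq sume_ge0// => z zs.
  by rewrite mule_ge0// lee_fin// s0// in_cons zs orbT.
Qed.

Lemma integral_like_ext (I J : (T -> \bar R) -> \bar R) :
  integral_like I -> integral_like J ->
  (forall A, measurable A -> I (fun x => (\1_A x)%:E) =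
    J (fun x => (\1_A x)%:E)) ->
  forall f, measurable_fun [set: T] f -> (forall x, 0 <= f x) -> I f = J f.
Proof.
move=> HI HJ IJ f mf f0.
pose f_ := nnsfun_approx measurableT mf.
have mf_ n : measurable_fun [set: T] (EFin \o f_ n) by exact/measurable_EFinP.
have f_0 n x : 0 <= (EFin \o f_ n) x by rewrite lee_fin.
have ndf x : nondecreasing_seq ((fun n => EFin \o f_ n) ^~ x).
  by move=> m n mn; rewrite lee_fin; exact/lefP/nd_nnsfun_approx.
have cf x : (EFin \o f_ n) x @[n --> \oo] --> f x.
  by apply: cvg_nnsfun_approx.
have [_ _ IM] := HI; have [_ _ JM] := HJ.
have /cvg_lim <- // := IM _ _ mf_ f_0 ndf cf.
have /cvg_lim <- // := JM _ _ mf_ f_0 ndf cf.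
congr (limn _); apply/funext => n.
rewrite !integral_like_nnsfun//; apply: eq_bigr => y _; congr (_ * _).
exact: IJ.
Qed.

End functional.

Section functional_instances.
Local Open Scope ereal_scope.
Context d1 d2 (X : measurableType d1) (Y : measurableType d2) (R : realType).

Lemma integral_like_kernel (mu : {measure set X -> \bar R}) (w : X -> R)
    (k : R.-pker X ~> Y) :
  measurable_fun [set: X] w -> (forall x, 0 <= w x)%R ->
  integral_like (fun f : X * Y -> \bar R =>
    \int[mu]_x ((w x)%:E * \int[k x]_y f (x, y))).
Proof.
move=> mw w0.
have mI f : measurable_fun [set: X * Y] f -> (forall z, 0 <= f z) ->
    measurable_fun [set: X] (fun x => (w x)%:E * \int[k x]_y f (x, y)).
  move=> mf f0; apply: emeasurable_funM; first exact/measurable_EFinP.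
  exact: (measurable_kfcomp k mf f0).
have I0 f x : (forall z, 0 <= f z) -> 0 <= (w x)%:E * \int[k x]_y f (x, y).
  by move=> f0; rewrite mule_ge0 ?lee_fin// integral_ge0.
split.
- move=> f g mf mg f0 g0; rewrite -ge0_integralD//;
    [|by move=> *; exact: I0|exact: mI|by move=> *; exact: I0|exact: mI].
  apply: eq_integral => x _; rewrite -ge0_muleDr ?integral_ge0//.
  rewrite ge0_integralD//; exact: measurable_fun_pair2.
- move=> c f c0 mf f0; rewrite -ge0_integralZl//;
    [|exact: mI|by move=> *; exact: I0].
  apply: eq_integral => x _; rewrite ge0_integralZl//; first by rewrite muleCA.
  exact: measurable_fun_pair2.
- move=> f_ f mf_ f0 ndf cf.
  have cx x : (w x)%:E * \int[k x]_y f_ n (x, y) @[n --> \oo] -->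
    (w x)%:E * \int[k x]_y f (x, y).
    apply: cvgeZl => //.
    rewrite (_ : (fun y => f (x, y)) = (fun y => limn (fun n => f_ n (x, y))));
      last first.
      by apply/funext => y; apply/esym/cvg_lim => //; exact: cf.
    apply: cvg_monotone_convergence => //.
    + by move=> n; exact: measurable_fun_pair2.
  rewrite (_ : (fun x => (w x)%:E * \int[k x]_y f (x, y)) =
    (fun x => limn (fun n => (w x)%:E * \int[k x]_y f_ n (x, y)))); last first.
    by apply/funext => x; apply/esym/cvg_lim => //; exact: cx.
  apply: cvg_monotone_convergence => //.
  + by move=> n; apply: mI.
  + by move=> n x _; apply: I0.
  + move=> x _ m n mn; apply: lee_wpmul2l; first by rewrite lee_fin.
    apply: ge0_le_integral => //; [exact: measurable_fun_pair2|exact: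
      measurable_fun_pair2|].
    by move=> y _; exact: ndf.
Qed.

Lemma integral_like_density (mu : {measure set X -> \bar R}) (w : X -> R) :
  measurable_fun [set: X] w -> (forall x, 0 <= w x)%R ->
  integral_like (fun f => \int[mu]_x ((w x)%:E * f x)).
Proof.
move=> mw w0.
have mI f : measurable_fun [set: X] f ->
  measurable_fun [set: X] (fun x => (w x)%:E * f x).
  by move=> mf; apply: emeasurable_funM => //; exact/measurable_EFinP.
have I0 f x : (forall z, 0 <= f z) -> 0 <= (w x)%:E * f x.
  by move=> f0; rewrite mule_ge0 ?lee_fin.
split.
- move=> f g mf mg f0 g0; rewrite -ge0_integralD//;
    [|by move=> *; exact: I0|exact: mI|by move=> *; exact: I0|exact: mI].
  by apply: eq_integral => x _; rewrite ge0_muleDr.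
- move=> c f c0 mf f0; rewrite -ge0_integralZl//;
    [|exact: mI|by move=> *; exact: I0].
  by apply: eq_integral => x _; rewrite muleCA.
- move=> f_ f mf_ f0 ndf cf.
  rewrite (_ : (fun x => (w x)%:E * f x) =
    (fun x => limn (fun n => (w x)%:E * f_ n x))); last first.
    by apply/funext => x; apply/esym/cvg_lim => //; apply: cvgeZl.
  apply: cvg_monotone_convergence => //.
  + by move=> n; apply: mI.
  + by move=> n x _; apply: I0.
  + by move=> x _ m n mn; apply: lee_wpmul2l; [rewrite lee_fin|exact: ndf].
Qed.
End functional_instances.

(** * Comparison of the posterior mean with another estimate *)

Lemma bounded_integrable d (T : measurableType d) (R : realType)
    (P : {measure set T -> \bar R}) (f : T -> R) (M : R) :
  (P [set: T] < +oo)%E -> measurable_fun [set: T] f ->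
    (forall x, `|f x| <= M) ->
  P.-integrable [set: T] (EFin \o f).
Proof.
move=> PT mf fM; apply: measurable_bounded_integrable => //.
exists M; split; first exact: num_real.
by move=> N MN x _; apply: (le_trans (fM x)); exact: ltW.
Qed.

(* With [t0] and [c0] the means of [phi] and [h], the last two terms have
   integral zero. *)
Lemma variance_comparison_pointwise (R : realType) (t0 tau phi h c c0 K : R) :
  `|phi - t0| <= 2 * K ->
  (t0 - phi) ^+ 2 * h ^+ 2 <= (tau - phi) ^+ 2 * h ^+ 2 + 16 * K ^+ 2 * (h - c)
    ^+ 2 +
    (- (tau - t0) ^+ 2 * c0 - 32 * K ^+ 2 * (c0 - c)) * (h - c0) +
    (2 * (tau - t0) * c0 ^+ 2) * (phi - t0).
Proof.
move=> pK; set e := tau - t0.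
have p2 : (phi - t0) ^+ 2 <= 4 * K ^+ 2.
  rewrite -real_normK ?num_real// (_ : 4 * K ^+ 2 = (2 * K) ^+ 2); last by ring.
  by rewrite lerXn2r ?nnegrE// (le_trans _ pK).
have p3 : 4 * ((phi - t0) ^+ 2 * (h - c0) ^+ 2) <= 16 * K ^+ 2 * (h - c0) ^+ 2.
  by rewrite mulrA; apply: ler_wpM2r; [exact: sqr_ge0|lra].
(* Centering turns the cross term into 2 e (phi - t0) (h^2 - c0^2), with h^2 - c0^2 = (h - c0) (h +
   c0). AM-GM splits it into e^2 (h + c0)^2 / 4, paid for by the excess loss of [tau], and 4 (phi -
   t0)^2 (h - c0)^2, where |phi - t0| <= 2K produces the constant 16 K^2. *)
have amgm := sqr_ge0 (e * (h + c0) / 2 - 2 * (phi - t0) * (h - c0)).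
have sq1 : 0 <= e ^+ 2 * (h - c0) ^+ 2 by rewrite mulr_ge0 ?sqr_ge0.
have sq2 : 0 <= K ^+ 2 * (c0 - c) ^+ 2 by rewrite mulr_ge0 ?sqr_ge0.
have -> : tau = e + t0 by rewrite /e subrK.
rewrite -subr_ge0.
have -> : (e + t0 - phi) ^+ 2 * h ^+ 2 + 16 * K ^+ 2 * (h - c) ^+ 2 +
    (- e ^+ 2 * c0 - 32 * K ^+ 2 * (c0 - c)) * (h - c0) +
    2 * e * c0 ^+ 2 * (phi - t0) - (t0 - phi) ^+ 2 * h ^+ 2 =
  (e * (h + c0) / 2 - 2 * (phi - t0) * (h - c0)) ^+ 2 +
  (16 * K ^+ 2 * (h - c0) ^+ 2 - 4 * ((phi - t0) ^+ 2 * (h - c0) ^+ 2)) +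
  3 / 4 * (e ^+ 2 * (h - c0) ^+ 2) + 16 * (K ^+ 2 * (c0 - c) ^+ 2) by field.
apply: addr_ge0; last by rewrite mulr_ge0.
apply: addr_ge0; last by rewrite mulr_ge0// divr_ge0.
by rewrite addr_ge0// subr_ge0.
Qed.

(** The mean minimizes the unweighted loss only, so the weight h^2 may favour another [tau]; its
    gain is at most 16 K^2 times the spread of [h] about any [c]. Here [tau] is a constant and all
    functions are bounded, so no integrability of a competing estimator is involved. *)
Lemma posterior_mean_comparison d (T : measurableType d) (R : realType)
    (P : {measure set T -> \bar R}) (phi h : T -> R) (K tau c : R) :
  P [set: T] = 1%E ->
  measurable_fun [set: T] phi -> measurable_fun [set: T] h ->
  (forall x, `|phi x| <= K) -> (forall x, `|h x| <= 1) ->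
  (\int[P]_x ((fine (\int[P]_y (phi y)%:E) - phi x) ^+ 2 * h x ^+ 2)%:E <=
   \int[P]_x ((tau - phi x) ^+ 2 * h x ^+ 2)%:E +
   (16 * K ^+ 2)%:E * \int[P]_x ((h x - c) ^+ 2)%:E)%E.
Proof.
move=> PT mphi mh phiK h1.
have PTy : (P [set: T] < +oo)%E by rewrite PT ltry.
have iphi := bounded_integrable PTy mphi phiK.
have ih := bounded_integrable PTy mh h1.
set t0 := fine _.
have t0E : t0 = \int[P]_x phi x by [].
pose c0 := \int[P]_x h x.
have t0K : `|t0| <= K.
  rewrite t0E; apply: (le_trans (le_normr_Rintegral _ _)) => //.
  apply: (@le_trans _ _ (\int[P]_x (cst K x))).
    apply: le_Rintegral => //.
    - exact: integrable_norm.
    - by apply: (@bounded_integrable _ _ _ _ _ `|K| PTy) => // x.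
  by rewrite Rintegral_cst// PT mulr1.
have p2K x : `|phi x - t0| <= 2 * K.
  by apply: (le_trans (ler_normB _ _)); have := phiK x; lra.
have K0 : 0 <= K by apply: le_trans t0K.
have iB (f : T -> R) (M : R) : measurable_fun [set: T] f ->
  (forall x, `|f x| <= M) ->
   forall u : R, P.-integrable [set: T]
     (EFin \o (fun x => (u - f x) ^+ 2 * h x ^+ 2)).
  move=> mf fM u; apply: (@bounded_integrable _ _ _ _ _ ((`|u| + M) ^+ 2) PTy).
    apply: measurable_funM; apply: measurable_funX => //.
    exact: measurable_funB.
  move=> x; rewrite normrM !normrX -[leRHS]mulr1; apply: ler_pM => //.
  - rewrite lerXn2r ?nnegrE//.
      by rewrite addr_ge0// (le_trans _ (fM x)).
    by apply: (le_trans (ler_normB _ _)); rewrite lerD2l.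
  - by rewrite exprn_ile1.
have iF := iB _ _ mphi phiK t0.
have iG := iB _ _ mphi phiK tau.
have iH : P.-integrable [set: T] (EFin \o (fun x => (h x - c) ^+ 2)).
  apply: (@bounded_integrable _ _ _ _ _ ((1 + `|c|) ^+ 2) PTy).
    by apply: measurable_funX; exact: measurable_funB.
  move=> x; rewrite normrX lerXn2r ?nnegrE ?addr_ge0//.
  by apply: (le_trans (ler_normB _ _)); rewrite lerD2r.
have icst u : P.-integrable [set: T] (EFin \o (cst u : T -> R)).
  by apply: (@bounded_integrable _ _ _ _ _ `|u| PTy) => // x.
have iZ (f : T -> R) (u : R) : P.-integrable [set: T] (EFin \o f) ->
    P.-integrable [set: T] (EFin \o (fun x => u * f x)).
  move=> intf; have := integrableZl measurableT u intf.
  by apply: eq_integrable.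
have iD (f g : T -> R) : P.-integrable [set: T] (EFin \o f) ->
    P.-integrable [set: T] (EFin \o g) ->
    P.-integrable [set: T] (EFin \o (fun x => f x + g x)).
  move=> intf intg; have := integrableD measurableT intf intg.
  by apply: eq_integrable.
have icen (f : T -> R) : P.-integrable [set: T] (EFin \o f) ->
    P.-integrable [set: T] (EFin \o (fun x => f x - \int[P]_y f y)).
  by move=> intf; exact: (iD _ _ intf (icst _)).
have cen (f : T -> R) : P.-integrable [set: T] (EFin \o f) ->
    \int[P]_x (f x - \int[P]_y f y) = 0.
  move=> intf; rewrite RintegralB//=; last exact: (icst (\int[P]_y f y)).
  by rewrite Rintegral_cst// PT mulr1 subrr.
pose al := - (tau - t0) ^+ 2 * c0 - 32 * K ^+ 2 * (c0 - c).
pose be := 2 * (tau - t0) * c0 ^+ 2.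
have main : \int[P]_x ((t0 - phi x) ^+ 2 * h x ^+ 2) <=
    \int[P]_x ((tau - phi x) ^+ 2 * h x ^+ 2) + 16 * K ^+ 2 * \int[P]_x
      ((h x - c) ^+ 2).
  apply: (@le_trans _ _ (\int[P]_x ((tau - phi x) ^+ 2 * h x ^+ 2 +
      16 * K ^+ 2 * (h x - c) ^+ 2 + al * (h x - c0) + be * (phi x - t0)))).
    apply: le_Rintegral => //.
    - by apply: (iD); [apply: (iD); [apply: (iD) => //;
        exact: iZ|exact: iZ (icen _ ih)]|exact: iZ (icen _ iphi)].
    - by move=> x _; exact: variance_comparison_pointwise.
  rewrite RintegralD//; [|by apply: (iD);
    [apply: (iD) => //; exact: iZ|exact: iZ (icen _ ih)]|exact: iZ
      (icen _ iphi)].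
  rewrite RintegralD//; [|by apply: (iD) => //;
    exact: iZ|exact: iZ (icen _ ih)].
  rewrite RintegralD//; [|exact: iZ].
  rewrite !RintegralZl//; [|exact: icen|exact: icen].
  by rewrite cen// t0E cen// !mulr0 !addr0.
have toE (f : T -> R) : P.-integrable [set: T] (EFin \o f) ->
    (\int[P]_x (f x)%:E = (\int[P]_x f x)%:E)%E.
  by move=> intf; rewrite /Rintegral fineK//; exact: integrable_fin_num.
by rewrite (toE _ iF) (toE _ iG) (toE _ iH) -EFinM -EFinD lee_fin.
Qed.

(** * The formal posterior *)

Section density_kernel.
Local Open Scope ereal_scope.
Context d1 d2 (X : measurableType d1) (Y : measurableType d2) (R : realType).
Variables (nu : {sigma_finite_measure set Y -> \bar R}) (g : X * Y -> R).
Hypotheses (mg : measurable_fun [set: X * Y] g) (g0 : forall z, (0 <= g z)%R).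

(** For the joint density this is the posterior before normalization, with total mass
    [marg_dens a b x]. *)
Definition density_mass (x : X) (B : set Y) : \bar R :=
  \int[nu]_y ((g (x, y))%:E * (\1_B y)%:E).

Let mgB x B : measurable B ->
  measurable_fun [set: Y] (fun y => (g (x, y))%:E * (\1_B y)%:E).
Proof.
move=> mB; apply: emeasurable_funM; apply/measurable_EFinP.
  exact: measurable_fun_pair2.
exact: measurable_indic.
Qed.

Let gB0 x B y : 0 <= (g (x, y))%:E * (\1_B y)%:E.
Proof. by rewrite -EFinM lee_fin mulr_ge0. Qed.

Let density_mass0 x : density_mass x set0 = 0.
Proof. by apply: integral0_eq => y _; rewrite indic0 mule0. Qed.

Let density_mass_ge0 x B : 0 <= density_mass x B.
Proof. by apply: integral_ge0. Qed.

Let density_mass_sigma_additive x : semi_sigma_additive (density_mass x).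
Proof.
move=> /= A mA tA mUA.
have -> : density_mass x (\bigcup_n A n) = \sum_(n <oo) density_mass x (A n).
  rewrite /density_mass -integral_nneseries//; last by move=> n; exact: mgB.
  apply: eq_integral => y _; rewrite nneseriesZl//.
  by congr (_ * _); rewrite indic_bigcup.
by apply: is_cvg_ereal_nneg_natsum_cond => n _ _.
Qed.

HB.instance Definition _ x := isMeasure.Build _ _ _ (density_mass x)
  (density_mass0 x) (density_mass_ge0 x) (@density_mass_sigma_additive x).

Definition density_measure : X -> {measure set Y -> \bar R} := density_mass.

Let measurable_density_measure B : measurable B ->
  measurable_fun [set: X] (density_measure ^~ B).
Proof.
move=> mB.
apply: (@measurable_fun_fubini_tonelli_F _ _ _ _ _ nu
  (fun z => (g z)%:E * (\1_B z.2)%:E)).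
  apply: emeasurable_funM; apply/measurable_EFinP => //.
  by apply: measurableT_comp => //; exact: measurable_indic.
by case=> x y; exact: gB0.
Qed.

HB.instance Definition _ := isKernel.Build _ _ X Y R density_measure
  measurable_density_measure.

Definition density_kernel : R.-ker X ~> Y := density_measure.

Lemma density_kernelE x B :
  density_kernel x B = \int[nu]_y ((g (x, y))%:E * (\1_B y)%:E).
Proof. by []. Qed.

End density_kernel.

Section posterior.
Context {R : realType} (p : nat) (a b : R).
Local Notation T := (p.-tuple R).
Local Notation L := (lebRn R p).

Definition joint_dens (z : T * T) : R :=
  prior_dens a b z.2 * normal_dens z.2 z.1.

Lemma measurable_joint_dens : measurable_fun [set: T * T] joint_dens.
Proof.
apply: measurable_funM; last exact: measurable_fun_normal_dens.
by apply: measurableT_comp => //; exact: measurable_prior_dens.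
Qed.

Lemma prior_dens_ge0 (th : T) : 0 <= prior_dens a b th.
Proof. exact: powR_ge0. Qed.

Lemma joint_dens_ge0 z : 0 <= joint_dens z.
Proof. by rewrite mulr_ge0 ?normal_dens_ge0 ?prior_dens_ge0. Qed.

Lemma marg_densE (x : T) :
  marg_dens a b x = (\int[L]_th (joint_dens (x, th))%:E)%E.
Proof.
rewrite /marg_dens intRnE//; last by move=> th;
  rewrite lee_fin (joint_dens_ge0 (x, th)).
apply/measurable_EFinP.
exact: (measurable_fun_pair2 x measurable_joint_dens).
Qed.

Lemma marg_dens_ge0 (x : T) : (0 <= marg_dens a b x)%E.
Proof. by rewrite marg_densE integral_ge0// => th _;
  rewrite lee_fin joint_dens_ge0. Qed.

Lemma measurable_marg_dens : measurable_fun [set: T] (@marg_dens R a b p).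
Proof.
rewrite (_ : @marg_dens R a b p = fun x =>
  \int[L]_th (joint_dens (x, th))%:E)%E; last first.
  by apply/funext => x; exact: marg_densE.
apply: (@measurable_fun_fubini_tonelli_F _ _ _ _ _ L (EFin \o joint_dens)) =>
  //.
  by apply/measurable_EFinP; exact: measurable_joint_dens.
by move=> z; rewrite lee_fin joint_dens_ge0.
Qed.

(** By Peetre's inequality, 1 + |th|^2 is at most a constant depending on [x] times 1 + |x - th|^2,
    and the Gaussian absorbs the cube of the latter. The exponent is that of the integrable weight
    at e = 1, so the marginal density will be finite at every point. *)
Lemma normal_dens_le_weight (x : T) : exists2 K : R, 0 <= K & forall th : T,
  normal_dens th x <= K * (1 + sqnorm th) `^ (- 1 - 2 * 1).
Proof.
have [K K0 HK] := @normal_dens_decay R p 3.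
exists (K * (2 * (1 + sqnorm x)) ^+ 3).
  by rewrite mulr_ge0// exprn_ge0// mulr_ge0// addr_ge0// sqnorm_ge0.
move=> th.
have th1 : 0 < 1 + sqnorm th by rewrite ltr_pwDl// sqnorm_ge0.
rewrite (_ : - 1 - 2 * 1 = - 3%:R); last by ring.
rewrite powR_invn ?(ltW th1)// ler_pdivlMr ?exprn_gt0//.
have P := peetre th x; rewrite sqdistC in P.
have N0 := normal_dens_ge0 th x.
apply: (@le_trans _ _ (normal_dens th x *
  (2 * (1 + sqnorm x) * (1 + sqdist x th)) ^+ 3)).
  apply: ler_wpM2l => //; rewrite lerXn2r ?nnegrE ?(ltW th1)//.
  by apply: le_trans P; exact: ltW.
rewrite exprMn mulrCA mulrC; apply: ler_wpM2r.
  by rewrite exprn_ge0// mulr_ge0// addr_ge0// sqnorm_ge0.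
apply: (le_trans (HK th x)); rewrite ler_piMr// -[leRHS]expR0 ler_expR.
by rewrite oppr_le0 divr_ge0// sqdist_ge0.
Qed.

Lemma intRn_jointE (f : T * T -> \bar R) : measurable_fun [set: T * T] f ->
  (forall z, 0 <= f z)%E ->
  (intRn (fun th => (prior_dens a b th)%:E *
      intRn (fun x => (normal_dens th x)%:E * f (x, th))) =
   \int[L \x L]_z ((joint_dens z)%:E * f z))%E.
Proof.
move=> mf f0.
have mnf : measurable_fun [set: T * T]
    (fun z => (normal_dens z.2 z.1)%:E * f z)%E.
  by apply: emeasurable_funM => //; apply/measurable_EFinP;
    exact: measurable_fun_normal_dens.
have nf0 z : (0 <= (normal_dens z.2 z.1)%:E * f z)%E.
  by rewrite mule_ge0// lee_fin normal_dens_ge0.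
have E1 th : intRn (fun x => (normal_dens th x)%:E * f (x, th))%E =
    (\int[L]_x ((normal_dens th x)%:E * f (x, th)))%E.
  rewrite intRnE//; first exact: (measurable_fun_pair1 th mnf).
  by move=> x; exact: (nf0 (x, th)).
under eq_fun do rewrite E1.
rewrite intRnE; last 2 first.
- apply: emeasurable_funM; first by apply/measurable_EFinP;
    exact: measurable_prior_dens.
  exact: (@measurable_fun_fubini_tonelli_G _ _ _ _ _ L _ mnf nf0).
- move=> th; rewrite mule_ge0 ?lee_fin ?prior_dens_ge0// integral_ge0// => x _.
  exact: (nf0 (x, th)).
rewrite fubini_tonelli2; last 2 first.
- by apply: emeasurable_funM => //; apply/measurable_EFinP;
    exact: measurable_joint_dens.
- by move=> z; rewrite mule_ge0// lee_fin joint_dens_ge0.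
apply: eq_integral => th _; rewrite -ge0_integralZl//.
- by apply: eq_integral => x _; rewrite muleA -EFinM.
- exact: (measurable_fun_pair1 th mnf).
- by move=> x _; exact: (nf0 (x, th)).
- by rewrite lee_fin prior_dens_ge0.
Qed.

Hypothesis marg_lty : forall x : T, (marg_dens a b x < +oo)%E.

Lemma fine_marg_dens (x : T) : ((fine (marg_dens a b x))%:E =
  marg_dens a b x)%E.
Proof. by rewrite fineK// ge0_fin_numE// marg_dens_ge0. Qed.

Lemma formal_posterior_exists : exists Q : R.-pker T ~> T, formal_posterior a b
  Q.
Proof.
(* Default posterior where the mass is 0 or infinite. Infinite mass is excluded by [marg_lty]; where
   the marginal density is 0, both sides of the identity vanish. *)
pose P0 : probability T R := dirac ([tuple of nseq p 0] : T).
pose k : R.-ker T ~> T := density_kernel L measurable_joint_dens joint_dens_ge0.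
pose Q : R.-pker T ~> T := knormalize k P0.
exists Q => C mC.
have mI : measurable_fun [set: T * T] (fun z => (\1_C z)%:E : \bar R).
  by apply/measurable_EFinP; exact: measurable_indic.
rewrite (@intRn_jointE (fun z => (\1_C z)%:E))//.
have mJI : measurable_fun [set: T * T]
  (fun z => (joint_dens z)%:E * (\1_C z)%:E)%E.
  by apply: emeasurable_funM => //; apply/measurable_EFinP;
    exact: measurable_joint_dens.
have JI0 z : (0 <= (joint_dens z)%:E * (\1_C z)%:E)%E.
  by rewrite -EFinM lee_fin mulr_ge0// joint_dens_ge0.
have kC x : (marg_dens a b x * Q x [set th | C (x, th)] =
    \int[L]_th ((joint_dens (x, th))%:E * (\1_C (x, th))%:E))%E.
  have mCx : measurable [set th | C (x, th)].
    by rewrite -[X in measurable X]xsectionE; exact: measurable_xsection.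
  have kT : k x setT = marg_dens a b x.
    rewrite /k density_kernelE marg_densE; apply: eq_integral => th _.
    by rewrite indicT mule1.
  have -> : (\int[L]_th ((joint_dens (x, th))%:E * (\1_C (x, th))%:E) =
      k x [set th | C (x, th)])%E.
    by rewrite /k density_kernelE.
  rewrite -[Q x _]/(mnormalize (k x) P0 [set th | C (x, th)]) /mnormalize kT.
  have [m0|m0] := eqVneq (marg_dens a b x) 0%E.
    rewrite m0 mul0e; apply/le_anti/andP; split;
      first exact: (measure_ge0 (k x)).
    by rewrite -m0 -kT; apply: (le_measure (k x)); rewrite ?inE//;
      exact: measurableT.
  rewrite (lt_eqF (marg_lty x))/= -[X in (X * _)%E]fine_marg_dens muleCA -EFinM
    divff ?mule1//.
  by apply: contra m0 => /eqP m0; rewrite -fine_marg_dens m0.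
rewrite intRnE.
- by rewrite fubini_tonelli1//; apply: eq_integral => x _; rewrite kC.
- under eq_fun do rewrite kC.
  exact: (@measurable_fun_fubini_tonelli_F _ _ _ _ _ L _ mJI JI0).
- by move=> x; rewrite kC integral_ge0// => th _; exact: (JI0 (x, th)).
Qed.

Lemma formal_posterior_integral (Q : R.-pker T ~> T) (f : T * T -> \bar R) :
  formal_posterior a b Q -> measurable_fun [set: T * T] f ->
    (forall z, 0 <= f z)%E ->
  (\int[L \x L]_z ((joint_dens z)%:E * f z) =
   \int[L]_x ((fine (marg_dens a b x))%:E * \int[Q x]_th f (x, th)))%E.
Proof.
move=> QP; move: f.
apply: (@integral_like_ext _ (T * T)%type R
  (fun f => \int[L \x L]_z ((joint_dens z)%:E * f z))%E
  (fun f => \int[L]_x ((fine (marg_dens a b x))%:E * \int[Q x]_th f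
    (x, th)))%E).
- by apply: integral_like_density; [exact: measurable_joint_dens|exact:
    joint_dens_ge0].
- apply: integral_like_kernel.
    by apply: measurableT_comp => //; exact: measurable_marg_dens.
  by move=> x; rewrite fine_ge0// marg_dens_ge0.
move=> C mC.
have mI : measurable_fun [set: T * T] (fun z => (\1_C z)%:E : \bar R).
  by apply/measurable_EFinP; exact: measurable_indic.
rewrite -(@intRn_jointE (fun z => (\1_C z)%:E))//.
rewrite (QP _ mC).
have QC x : Q x [set th | C (x, th)] = (\int[Q x]_th (\1_C (x, th))%:E)%E.
  have mCx : measurable [set th | C (x, th)].
    by rewrite -[X in measurable X]xsectionE; exact: measurable_xsection.
  by rewrite -[RHS]/(\int[Q x]_th (\1_[set th | C (x, th)] th)%:E)%E
    integral_indic// setIT.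
under eq_fun do rewrite QC.
rewrite intRnE.
- by apply: eq_integral => x _; rewrite fine_marg_dens.
- apply: emeasurable_funM; first exact: measurable_marg_dens.
  by apply: (measurable_kfcomp Q mI) => z; rewrite lee_fin.
- move=> x; rewrite mule_ge0 ?marg_dens_ge0// integral_ge0// => th _.

Qed.

End posterior.

(** * Blyth's method *)

Section blyth.
Context {R : realType} (p : nat) (a b : R).
Local Notation T := (p.-tuple R).
Local Notation L := (lebRn R p).
Hypothesis weight_le : exists2 C : R, 0 <= C & forall e : R, 0 < e -> e <= 1 ->
  (\int[L]_x (prior_dens a b x * (1 + sqnorm x) `^ (- 1 - 2 * e))%:E <=
    (C / e)%:E)%E.

Let mpw (c : R) : measurable_fun [set: T]
  (fun x => (prior_dens a b x * (1 + sqnorm x) `^ c)%:E).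
Proof.
apply/measurable_EFinP; apply: measurable_funM.
  exact: measurable_prior_dens.
exact: measurable_weight.
Qed.

Let pw_ge0 (c : R) (x : T) : 0 <= prior_dens a b x * (1 + sqnorm x) `^ c.
Proof. by rewrite mulr_ge0 ?powR_ge0// prior_dens_ge0. Qed.

Lemma marg_dens_lty (x : T) : (marg_dens a b x < +oo)%E.
Proof.
have [C C0 HC] := weight_le; have [K K0 HK] := normal_dens_le_weight x.
rewrite marg_densE.
apply: (@le_lt_trans _ _ (\int[L]_th (K%:E * (prior_dens a b th *
    (1 + sqnorm th) `^ (- 1 - 2 * 1))%:E))%E).
  apply: ge0_le_integral => //.
  - by move=> th _; rewrite lee_fin joint_dens_ge0.
  - apply/measurable_EFinP; exact: (measurable_fun_pair2 x
      (measurable_joint_dens a b)).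
  - exact: measurable_funeM.
  - move=> th _; rewrite -EFinM lee_fin mulrCA; apply: ler_wpM2l => //.
    exact: prior_dens_ge0.
rewrite ge0_integralZl//; last by move=> th _; rewrite lee_fin.
apply: (@le_lt_trans _ _ (K%:E * (C / 1)%:E)%E); last by rewrite -EFinM ltry.
by apply: lee_wpmul2l; [rewrite lee_fin|exact: HC].
Qed.

(** The density of Blyth's finite prior, left unnormalized. *)
Definition cutoff_prior (e : R) (th : T) : R :=
  prior_dens a b th * cutoff e th ^+ 2.

Lemma measurable_cutoff_prior (e : R) : measurable_fun [set: T]
  (cutoff_prior e).
Proof.
apply: measurable_funM; first exact: measurable_prior_dens.
by apply: measurable_funX; exact: measurable_cutoff.
Qed.

Lemma cutoff_prior_ge0 (e : R) (th : T) : 0 <= cutoff_prior e th.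
Proof. by rewrite mulr_ge0 ?prior_dens_ge0 ?sqr_ge0. Qed.

Lemma integral_cutoff_prior_lty (e : R) : 0 < e -> e <= 1 ->
  (\int[L]_th (cutoff_prior e th)%:E < +oo)%E.
Proof.
move=> e0 e1; have [C C0 HC] := weight_le.
pose k := e `^ (- ((1 + 2 * e) / e)).
apply: (@le_lt_trans _ _ (\int[L]_th (k%:E * (prior_dens a b th *
    (1 + sqnorm th) `^ (- 1 - 2 * e))%:E))%E).
  apply: ge0_le_integral => //.
  - by move=> th _; rewrite lee_fin cutoff_prior_ge0.
  - by apply/measurable_EFinP; exact: measurable_cutoff_prior.
  - exact: measurable_funeM.
  - move=> th _; rewrite -EFinM lee_fin mulrCA; apply: ler_wpM2l.
      exact: prior_dens_ge0.
    exact: cutoff_sqr_le.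
rewrite ge0_integralZl//; last 2 first.
- by move=> th _; rewrite lee_fin.
- by rewrite lee_fin powR_ge0.
apply: (@le_lt_trans _ _ (k%:E * (C / e)%:E)%E); last by rewrite -EFinM ltry.
by apply: lee_wpmul2l; [rewrite lee_fin powR_ge0|exact: HC].
Qed.

(** The increment bound is applied with [th] as first point: its weight then depends on [th] alone,
    and the inner integral in [x] is a Gaussian moment bounded uniformly in [th]. What remains is
    e^2 times an integral of order 1 / e. *)
Lemma cutoff_energy_le : exists2 C : R, 0 <= C & forall e : R, 0 < e -> e <=
  1 ->
  (\int[L \x L]_z ((joint_dens a b z)%:E *
    ((cutoff e z.2 - cutoff e z.1) ^+ 2)%:E)
    <= (C * e)%:E)%E.
Proof.
have [C C0 HC] := weight_le; have [C6 C60 HC6] := @integral_normal_moment R p 6.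
exists (64 * C6 * C); first by rewrite mulr_ge0// mulr_ge0.
move=> e e0 e1.
have mn6 (th : T) : measurable_fun [set: T]
    (fun x => (normal_dens th x * (1 + sqdist x th) ^+ 6)%:E).
  apply/measurable_EFinP; apply: measurable_funM;
    first exact: measurable_fun_normal_dens.
  apply: measurable_funX; apply: measurable_funD => //.
  exact: measurable_fun_sqdist.
have n60 (th x : T) : 0 <= normal_dens th x * (1 + sqdist x th) ^+ 6.
  by rewrite mulr_ge0 ?normal_dens_ge0// exprn_ge0// addr_ge0// sqdist_ge0.
have mF : measurable_fun [set: T * T] (fun z =>
    (joint_dens a b z)%:E * ((cutoff e z.2 - cutoff e z.1) ^+ 2)%:E)%E.
  apply: emeasurable_funM; apply/measurable_EFinP;
    first exact: measurable_joint_dens.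
  apply: measurable_funX; apply: measurable_funB.
    by apply: measurableT_comp => //; exact: measurable_cutoff.
  by apply: measurableT_comp => //; exact: measurable_cutoff.
have F0 (z : T * T) : (0 <= (joint_dens a b z)%:E *
  ((cutoff e z.2 - cutoff e z.1) ^+ 2)%:E)%E.
  by rewrite -EFinM lee_fin mulr_ge0 ?sqr_ge0// joint_dens_ge0.
rewrite fubini_tonelli2//.
pose w (th : T) := prior_dens a b th * (1 + sqnorm th) `^ (- 1 - 2 * e).
apply: (@le_trans _ _ (\int[L]_th ((64 * e ^+ 2 * C6)%:E * (w th)%:E))%E).
  apply: ge0_le_integral => //.
  - by move=> th _; apply: integral_ge0 => x _;
      rewrite -EFinM lee_fin mulr_ge0 ?sqr_ge0// joint_dens_ge0.
  - exact: (@measurable_fun_fubini_tonelli_G _ _ _ _ _ L _ mF F0).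
  - by apply: measurable_funeM; exact: mpw.
  move=> th _.
  have w0 : 0 <= w th by exact: pw_ge0.
  rewrite /fubini_G; apply: (@le_trans _ _ (\int[L]_x ((64 * e ^+ 2 * w th)%:E *
      (normal_dens th x * (1 + sqdist x th) ^+ 6)%:E))%E).
    apply: ge0_le_integral => //.
    + exact: (measurable_fun_pair1 th mF).
    + exact: measurable_funeM.
    + move=> x _; rewrite -!EFinM lee_fin /joint_dens/= /w.
      have H := cutoff_sqrB_le th x e0 e1; rewrite sqdistC in H.
      have J0 := joint_dens_ge0 a b (x, th).
      apply: (le_trans (ler_wpM2l J0 H)); rewrite /joint_dens/=.
      by rewrite le_eqVlt; apply/orP; left; apply/eqP; ring.
  rewrite ge0_integralZl//; last 2 first.
  - by move=> x _; rewrite lee_fin.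
  - by rewrite lee_fin mulr_ge0// mulr_ge0// sqr_ge0.
  rewrite (_ : (64 * e ^+ 2 * C6)%:E * (w th)%:E =
    (64 * e ^+ 2 * w th)%:E * C6%:E)%E; last first.
    by rewrite -!EFinM mulrAC.
  apply: lee_wpmul2l; last exact: HC6.
  by rewrite lee_fin mulr_ge0// mulr_ge0// sqr_ge0.
rewrite ge0_integralZl//; last 3 first.
- exact: mpw.
- by move=> th _; rewrite lee_fin pw_ge0.
- by rewrite lee_fin mulr_ge0// mulr_ge0// sqr_ge0.
apply: (@le_trans _ _ ((64 * e ^+ 2 * C6)%:E * (C / e)%:E)%E).
  by apply: lee_wpmul2l; [rewrite lee_fin mulr_ge0// mulr_ge0// sqr_ge0|exact:
    HC].
rewrite -EFinM lee_fin le_eqVlt; apply/orP; left; apply/eqP.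
by field; rewrite gt_eqF.
Qed.

Section risk.
Variables (phi : T -> R) (mphi : measurable_fun [set: T] phi).

Let mloss (t : T -> R) : measurable_fun [set: T] t ->
  measurable_fun [set: T * T] (fun z => (t z.1 - phi z.2) ^+ 2).
Proof.
move=> mt; apply: measurable_funX; apply: measurable_funB;
  exact: measurableT_comp.
Qed.

Let mlossn (t : T -> R) : measurable_fun [set: T] t ->
  measurable_fun [set: T * T] (fun z =>
    ((t z.1 - phi z.2) ^+ 2 * normal_dens z.2 z.1)%:E).
Proof.
move=> mt; apply/measurable_EFinP; apply: measurable_funM; first exact: mloss.
exact: measurable_fun_normal_dens.
Qed.

Let lossn0 (t : T -> R) (th x : T) : 0 <=
  (t x - phi th) ^+ 2 * normal_dens th x.
Proof. by rewrite mulr_ge0 ?sqr_ge0// normal_dens_ge0. Qed.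

Lemma riskE (t : T -> R) (th : T) : measurable_fun [set: T] t ->
  risk phi t th = (\int[L]_x ((t x - phi th) ^+ 2 * normal_dens th x)%:E)%E.
Proof.
move=> mt; rewrite /risk intRnE// => [|x]; last by rewrite lee_fin lossn0.
exact: (measurable_fun_pair1 th (mlossn mt)).
Qed.

Lemma risk_ge0 (t : T -> R) (th : T) : measurable_fun [set: T] t ->
  (0 <= risk phi t th)%E.
Proof. by move=> mt; rewrite riskE// integral_ge0// => x _;
  rewrite lee_fin lossn0. Qed.

Lemma measurable_risk (t : T -> R) : measurable_fun [set: T] t ->
  measurable_fun [set: T] (risk phi t).
Proof.
move=> mt; rewrite (_ : risk phi t = fun th =>
    \int[L]_x ((t x - phi th) ^+ 2 * normal_dens th x)%:E)%E; last first.
  by apply/funext => th; exact: riskE.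
apply: (@measurable_fun_fubini_tonelli_G _ _ _ _ _ L _ (mlossn mt)).
by move=> z; rewrite lee_fin lossn0.
Qed.

Lemma integral_cutoff_risk (t : T -> R) (e : R) : measurable_fun [set: T] t ->
  (\int[L]_th ((cutoff_prior e th)%:E * risk phi t th) =
   \int[L \x L]_z ((joint_dens a b z)%:E *
      ((t z.1 - phi z.2) ^+ 2 * cutoff e z.2 ^+ 2)%:E))%E.
Proof.
move=> mt; rewrite fubini_tonelli2; last 2 first.
- apply: emeasurable_funM; apply/measurable_EFinP;
    first exact: measurable_joint_dens.
  apply: measurable_funM; first exact: mloss.
  by apply: measurable_funX; apply: measurableT_comp => //;
    exact: measurable_cutoff.
- by move=> z; rewrite -EFinM lee_fin mulr_ge0 ?joint_dens_ge0// mulr_ge0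
    ?sqr_ge0.
apply: eq_integral => th _; rewrite riskE// -ge0_integralZl//.
- apply: eq_integral => x _; rewrite -!EFinM; congr EFin.
  by rewrite /cutoff_prior /joint_dens/=; ring.
- exact: (measurable_fun_pair1 th (mlossn mt)).
- by move=> x _; rewrite lee_fin lossn0.
- by rewrite lee_fin cutoff_prior_ge0.
Qed.

End risk.
End blyth.

(** * Admissibility of the formal Bayes estimator of a bounded function *)

Section bayes.
Context {R : realType} (p : nat) (a b : R).
Local Notation T := (p.-tuple R).
Local Notation L := (lebRn R p).
Hypothesis weight_le : exists2 C : R, 0 <= C & forall e : R, 0 < e -> e <= 1 ->
  (\int[L]_x (prior_dens a b x * (1 + sqnorm x) `^ (- 1 - 2 * e))%:E <=
    (C / e)%:E)%E.
Variables (Q : R.-pker T ~> T) (phi : T -> R) (K : R).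
Hypotheses (QP : formal_posterior a b Q) (mphi : measurable_fun [set: T] phi)
  (phiK : forall th, `|phi th| <= K).

Let QTy x : (Q x [set: T] < +oo)%E.
Proof. by rewrite prob_kernel ltry. Qed.

Let K0 : 0 <= K.
Proof. exact: (le_trans (normr_ge0 _) (phiK [tuple of nseq p 0])). Qed.

Lemma bayes_est_norm_le (x : T) : `|bayes_est Q phi x| <= K.
Proof.
have iphi := bounded_integrable (QTy x) mphi phiK.
apply: (le_trans (le_normr_Rintegral _ iphi)) => //.
apply: (@le_trans _ _ (\int[Q x]_y (cst K y))).
  apply: le_Rintegral => //.
  - exact: integrable_norm.
  - by apply: (@bounded_integrable _ _ _ _ _ `|K| (QTy x)) => // y.
by rewrite Rintegral_cst// prob_kernel mulr1.
Qed.

Lemma measurable_bayes_est : measurable_fun [set: T] (bayes_est Q phi).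
Proof.
have mK : measurable_fun [set: T] (fun th => phi th + K) by exact:
  measurable_funD.
have pK0 th : 0 <= phi th + K.
  by rewrite -lerBlDr sub0r; have := phiK th; rewrite ler_norml => /andP[].
(* Adding [K] makes the integrand nonnegative, as the measurability of kernel integrals requires;
   [Q x] has mass 1, so [K] is subtracted afterwards. *)
have E x : bayes_est Q phi x = fine (\int[Q x]_th (phi th + K)%:E)%E - K.
  have iphi := bounded_integrable (QTy x) mphi phiK.
  rewrite [X in X - K](_ : _ = \int[Q x]_th (phi th + cst K th))//.
  rewrite RintegralD//; first by rewrite Rintegral_cst// prob_kernel mulr1
    addrK.
  by apply: (@bounded_integrable _ _ _ _ _ `|K| (QTy x)) => // y.
rewrite (_ : bayes_est Q phi = fun x =>
  fine (\int[Q x]_th (phi th + K)%:E)%E - K); last exact/funext.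
apply: measurable_funB => //; apply: measurableT_comp => //.
apply: measurable_fun_integral_kernel.
- by move=> U mU; exact: measurable_kernel.
- by move=> th; rewrite lee_fin.
- exact/measurable_EFinP.
Qed.

(** Estimate and target both lie in [-K, K], and the moment of order 0 bounds the Gaussian mass.
    Finite risks are what allows them to be subtracted. *)
Lemma risk_bayes_est_le : exists2 M : R, 0 <= M &
  forall th, (risk phi (bayes_est Q phi) th <= M%:E)%E.
Proof.
have [C C0 HC] := @integral_normal_moment R p 0.
exists (4 * K ^+ 2 * C); first by rewrite mulr_ge0// mulr_ge0// sqr_ge0.
move=> th; rewrite riskE//; last exact: measurable_bayes_est.
have mn : measurable_fun [set: T] (fun x =>
  (normal_dens th x * (1 + sqdist x th) ^+ 0)%:E).
  under eq_fun do rewrite expr0 mulr1.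
  by apply/measurable_EFinP; exact: measurable_fun_normal_dens.
apply: (@le_trans _ _ (\int[L]_x ((4 * K ^+ 2)%:E *
    (normal_dens th x * (1 + sqdist x th) ^+ 0)%:E))%E).
  apply: ge0_le_integral => //.
  - by move=> x _; rewrite lee_fin mulr_ge0 ?sqr_ge0// normal_dens_ge0.
  - apply/measurable_EFinP; apply: measurable_funM;
      last exact: measurable_fun_normal_dens.
    by apply: measurable_funX; apply: measurable_funB => //;
      exact: measurable_bayes_est.
  - exact: measurable_funeM.
  - move=> x _; rewrite -EFinM lee_fin expr0 mulr1; apply: ler_wpM2r.
      exact: normal_dens_ge0.
    rewrite -real_normK ?num_real// (_ : 4 * K ^+ 2 = (2 * K) ^+ 2);
      last by ring.
    rewrite lerXn2r ?nnegrE ?mulr_ge0//.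
    apply: (le_trans (ler_normB _ _)).
    by have := bayes_est_norm_le x; have := phiK th; lra.
rewrite ge0_integralZl//.
- by rewrite [leRHS]EFinM; apply: lee_wpmul2l;
    [rewrite lee_fin mulr_ge0// sqr_ge0|exact: HC].
- by move=> x _; rewrite lee_fin expr0 mulr1 normal_dens_ge0.
- by rewrite lee_fin mulr_ge0// sqr_ge0.
Qed.

Lemma cutoff_risk_comparison (t : T -> R) (e : R) : measurable_fun [set: T] t ->
  0 < e -> e <= 1 ->
  (\int[L]_th ((cutoff_prior a b e th)%:E * risk phi (bayes_est Q phi) th) <=
   \int[L]_th ((cutoff_prior a b e th)%:E * risk phi t th) +
   (16 * K ^+ 2)%:E * \int[L \x L]_z ((joint_dens a b z)%:E *
      ((cutoff e z.2 - cutoff e z.1) ^+ 2)%:E))%E.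
Proof.
move=> mt e0 e1.
have mt0 := measurable_bayes_est.
have mL (s : T -> R) : measurable_fun [set: T] s -> measurable_fun [set: T * T]
    (fun z => ((s z.1 - phi z.2) ^+ 2 * cutoff e z.2 ^+ 2)%:E).
  move=> ms; apply/measurable_EFinP; apply: measurable_funM.
    by apply: measurable_funX; apply: measurable_funB; exact: measurableT_comp.
  by apply: measurable_funX; apply: measurableT_comp => //;
    exact: measurable_cutoff.
have L0 (s : T -> R) (z : T * T) : (0 <=
  ((s z.1 - phi z.2) ^+ 2 * cutoff e z.2 ^+ 2)%:E)%E.
  by rewrite lee_fin mulr_ge0 ?sqr_ge0.
have mE : measurable_fun [set: T * T] (fun z =>
  ((cutoff e z.2 - cutoff e z.1) ^+ 2)%:E).
  apply/measurable_EFinP; apply: measurable_funX; apply: measurable_funB.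
    by apply: measurableT_comp => //; exact: measurable_cutoff.
  by apply: measurableT_comp => //; exact: measurable_cutoff.
have E0 (z : T * T) : (0 <= ((cutoff e z.2 - cutoff e z.1) ^+ 2)%:E)%E.
  by rewrite lee_fin sqr_ge0.
have mlty := marg_dens_lty weight_le.
rewrite !integral_cutoff_risk// (formal_posterior_integral mlty QP (mL _ mt0)
  (L0 _)).
rewrite (formal_posterior_integral mlty QP (mL _ mt) (L0 _)).
rewrite (formal_posterior_integral mlty QP mE E0).
have w0 (x : T) : (0 <= (fine (marg_dens a b x))%:E)%E.
  by rewrite lee_fin fine_ge0// marg_dens_ge0.
have mI (f : T * T -> \bar R) : measurable_fun [set: T * T] f ->
  (forall z, 0 <= f z)%E ->
   measurable_fun [set: T] (fun x => (fine (marg_dens a b x))%:E * \int[Q x]_th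
     f (x, th))%E.
  move=> mf f0; apply: emeasurable_funM.
    apply/measurable_EFinP; apply: measurableT_comp => //;
      exact: measurable_marg_dens.
  exact: (measurable_kfcomp Q mf f0).
have I0 (f : T * T -> \bar R) x : (forall z, 0 <= f z)%E ->
   (0 <= (fine (marg_dens a b x))%:E * \int[Q x]_th f (x, th))%E.
  by move=> f0; rewrite mule_ge0// integral_ge0.
have k0 : (0 <= (16 * K ^+ 2)%:E :> \bar R)%E by rewrite lee_fin mulr_ge0//
  sqr_ge0.
rewrite -ge0_integralZl//; last 2 first.
- exact: (mI _ mE E0).
- by move=> x _; exact: (I0 _ _ E0).
rewrite -ge0_integralD//; last 4 first.
- by move=> x _; exact: (I0 _ _ (L0 _)).
- exact: (mI _ (mL _ mt) (L0 _)).
- by move=> x _; apply: mule_ge0 => //; exact: (I0 _ _ E0).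
- by apply: measurable_funeM; exact: (mI _ mE E0).
apply: ge0_le_integral => //.
- by move=> x _; exact: (I0 _ _ (L0 _)).
- exact: (mI _ (mL _ mt0) (L0 _)).
- apply: emeasurable_funD; first exact: (mI _ (mL _ mt) (L0 _)).
  by apply: measurable_funeM; exact: (mI _ mE E0).
move=> x _; rewrite muleCA -ge0_muleDr; last 2 first.
- by apply: integral_ge0 => th _; exact: (L0 t (x, th)).
- by rewrite mule_ge0// integral_ge0// => th _; exact: (E0 (x, th)).
apply: lee_wpmul2l => //.
(* With [x] fixed, [t x] and [cutoff e x] are constants for the posterior. *)
apply: (@posterior_mean_comparison _ _ _ (Q x) phi (cutoff e) K (t x)
  (cutoff e x)) => //.
- exact: prob_kernel.
- exact: measurable_cutoff.
- by move=> th; rewrite ger0_norm ?cutoff_ge0// cutoff_le1// ltW.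
Qed.

Lemma bayes_est_almost_admissible : almost_nu_admissible a b phi
  (bayes_est Q phi).
Proof.
move=> t mt tle; set t0 := bayes_est Q phi in tle *.
have mt0 : measurable_fun [set: T] t0 := measurable_bayes_est.
have [M M0 HM] := risk_bayes_est_le.
have r0f th : (risk phi t0 th \is a fin_num)%E.
  by rewrite ge0_fin_numE ?risk_ge0// (le_lt_trans (HM th))// ltry.
have rtf th : (risk phi t th \is a fin_num)%E.
  by rewrite ge0_fin_numE ?risk_ge0// (le_lt_trans (tle th))//
    (le_lt_trans (HM th))// ltry.
pose D th := fine (risk phi t0 th) - fine (risk phi t th).
have D0 th : 0 <= D th by rewrite subr_ge0 fine_le.
have mD : measurable_fun [set: T] D.
  by apply: measurable_funB; apply: measurableT_comp => //;
    exact: measurable_risk.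
have rD th : risk phi t0 th = (risk phi t th + (D th)%:E)%E.
  by rewrite -[X in (X + _)%E]fineK// -EFinD /D addrC subrK fineK.
have [C C0 HC] := cutoff_energy_le weight_le.
have cpD (e : R) : 0 < e -> e <= 1 ->
    (\int[L]_th (cutoff_prior a b e th * D th)%:E <=
      (16 * K ^+ 2 * (C * e))%:E)%E.
  move=> e0 e1.
  have mcp : measurable_fun [set: T] (fun th => (cutoff_prior a b e th)%:E).
    by apply/measurable_EFinP; exact: measurable_cutoff_prior.
  have cp0 th : (0 <= (cutoff_prior a b e th)%:E)%E by rewrite lee_fin
    cutoff_prior_ge0.
  have mr : measurable_fun [set: T] (fun th =>
    (cutoff_prior a b e th)%:E * risk phi t th)%E.
    by apply: emeasurable_funM => //; exact: measurable_risk.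
  have r0 th : (0 <= (cutoff_prior a b e th)%:E * risk phi t th)%E.
    by rewrite mule_ge0// risk_ge0.
  (* Finiteness permits cancelling this term from both sides of the comparison. *)
  have fint : (\int[L]_th ((cutoff_prior a b e th)%:E * risk phi t th) \is a
    fin_num)%E.
    rewrite ge0_fin_numE; last by apply: integral_ge0 => th _.
    apply: (@le_lt_trans _ _ (\int[L]_th
      (M%:E * (cutoff_prior a b e th)%:E))%E).
      apply: ge0_le_integral => //; first exact: measurable_funeM.
      move=> th _; rewrite muleC; apply: lee_wpmul2r => //.
      exact: le_trans (tle th) (HM th).
    rewrite ge0_integralZl//.
    have := integral_cutoff_prior_lty weight_le e0 e1.
    by move=> H; rewrite lte_mul_pinfty// lee_fin.
  have H := cutoff_risk_comparison mt e0 e1.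
  have H1 : (\int[L]_th ((cutoff_prior a b e th)%:E * risk phi t0 th) =
      \int[L]_th ((cutoff_prior a b e th)%:E * risk phi t th) +
      \int[L]_th (cutoff_prior a b e th * D th)%:E)%E.
    rewrite -ge0_integralD//.
    - by apply: eq_integral => th _; rewrite rD ge0_muleDr ?risk_ge0// lee_fin.
    - by move=> th _; rewrite lee_fin mulr_ge0// cutoff_prior_ge0.
    - by apply/measurable_EFinP; apply: measurable_funM => //;
        exact: measurable_cutoff_prior.
  rewrite -/t0 H1 leeD2lE// in H.
  apply: (le_trans H); rewrite [leRHS]EFinM; apply: lee_wpmul2l.
    by rewrite lee_fin mulr_ge0// sqr_ge0.
  exact: HC.
have mpD : measurable_fun [set: T] (fun th => (prior_dens a b th * D th)%:E).
  by apply/measurable_EFinP; apply: measurable_funM => //;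
    exact: measurable_prior_dens.
have pD0 th : 0 <= prior_dens a b th * D th by rewrite mulr_ge0//
  prior_dens_ge0.
have intD : (\int[L]_th (prior_dens a b th * D th)%:E = 0)%E.
  apply/le_anti/andP; split; last by apply: integral_ge0 => th _;
    rewrite lee_fin.
  apply/lee_addgt0Pr => d d0; rewrite add0e.
  (* 64 = 16 * 4, with 16 from the comparison and 4 making up for a cutoff that is only known to be
     at least 1/2. Dividing by [B + 1] avoids the case B = 0. *)
  pose B := 64 * K ^+ 2 * C.
  have B0 : 0 <= B by rewrite mulr_ge0// mulr_ge0// sqr_ge0.
  pose r := Num.min 1 (d / (B + 1)).
  have r0 : 0 < r by rewrite lt_min ltr01 divr_gt0// ltr_wpDl.
  have r1 : r <= 1 by rewrite ge_min lexx.
  have Br : B * r <= d.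
    have : B * r <= B * (d / (B + 1)) by apply: ler_wpM2l => //;
      rewrite ge_min lexx orbT.
    move=> /le_trans; apply; rewrite mulrA ler_pdivrMr ?ltr_wpDl//; nra.
  pose e (n : nat) := r / n.+1%:R.
  have e0 n : 0 < e n by rewrite divr_gt0.
  have er n : e n <= r by rewrite ler_pdivrMr// ler_peMr ?ler1n// ltW.
  apply: (@le_integral_eventually _ _ _ L _
    (fun n th => (4 * (cutoff_prior a b (e n) th * D th))%:E)) => //.
  - move=> n; apply/measurable_EFinP; apply: measurable_funM => //.
    by apply: measurable_funM => //; exact: measurable_cutoff_prior.
  - by move=> n th; rewrite lee_fin mulr_ge0// mulr_ge0// cutoff_prior_ge0.
  - move=> th; have w0 := sqnorm_ge0 th.
    pose l := 1 + ln (1 + sqnorm th).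
    have l0 : 0 <= l by rewrite addr_ge0// ln_ge0// lerDl.
    exists (Num.bound (2 * l)) => n Nn;
      rewrite lee_fin /cutoff_prior mulrCA [leRHS]mulrA.
    rewrite [leRHS](_ : _ = prior_dens a b th * D th *
      (4 * cutoff (e n) th ^+ 2)); last by ring.
    rewrite ler_peMr//.
    have half : 2^-1 <= cutoff (e n) th.
      apply: cutoff_ge_half; first exact: ltW.
      rewrite -/l /e mulrAC ler_pdivrMr//.
      have h1 : r * l <= l by rewrite ler_piMl.
      have h2 : 2 * l < n.+1%:R.
        apply: (lt_le_trans (archi_boundP _)); first by rewrite mulr_ge0.
        by rewrite ler_nat (leq_trans Nn).
      lra.
    have := cutoff_ge0 (e n) th; nra.
  - move=> n; under eq_integral do rewrite EFinM.
    rewrite ge0_integralZl//; last 2 first.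
    + apply/measurable_EFinP; apply: measurable_funM => //.
      exact: measurable_cutoff_prior.
    + by move=> th _; rewrite lee_fin mulr_ge0// cutoff_prior_ge0.
    apply: (@le_trans _ _ (4%:E * (16 * K ^+ 2 * (C * e n))%:E)%E).
      by apply: lee_wpmul2l; [rewrite lee_fin|apply: cpD => //;
        exact: le_trans (er n) r1].
    rewrite -EFinM lee_fin; apply: le_trans Br.
    rewrite (_ : 4 * _ = B * e n); last by rewrite /B; ring.
    exact: ler_wpM2l.
pose N := D @^-1` `]0, +oo[%classic.
have mN : measurable N by rewrite -[N]setTI; exact: mD.
exists N; split => //.
  move=> th /=; rewrite /N/= in_itv/= andbT subr_gt0 => H.
  by rewrite -lte_fin !fineK.
rewrite /prior intRnE; last 2 first.
- apply: emeasurable_funM; apply/measurable_EFinP;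
    first exact: measurable_prior_dens.
  exact: measurable_indic.
- by move=> th; rewrite -EFinM lee_fin mulr_ge0// prior_dens_ge0.
apply/le_anti/andP; split; last first.
  by apply: integral_ge0 => th _; rewrite -EFinM lee_fin mulr_ge0//
    prior_dens_ge0.
(* On [N], n * D th >= 1 once [n] exceeds the inverse of [D th], so the indicator of [N] is
   eventually below n * D, whose prior integral is 0 for every [n]. *)
apply: (@le_integral_eventually _ _ _ L _
  (fun n th => (n%:R%:E * (prior_dens a b th * D th)%:E)%E)).
- apply: emeasurable_funM; apply/measurable_EFinP;
    first exact: measurable_prior_dens.
  exact: measurable_indic.
- by move=> th; rewrite -EFinM lee_fin mulr_ge0// prior_dens_ge0.
- by move=> n; exact: measurable_funeM.
- by move=> n th; rewrite -EFinM lee_fin mulr_ge0.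
- move=> th; have [DN|DN] := boolP (th \in N).
    have Dp : 0 < D th by move: DN; rewrite inE /N/= in_itv/= andbT.
    exists (Num.bound (D th)^-1) => n Nn;
      rewrite -!EFinM lee_fin indicE DN mulr1.
    rewrite mulrCA ler_peMr ?prior_dens_ge0//.
    rewrite -ler_pdivrMr// div1r; apply: (le_trans (ltW (archi_boundP _))).
      by rewrite invr_ge0.
    by rewrite ler_nat.
  exists 0%N => n _; rewrite -!EFinM lee_fin indicE (negbTE DN) mulr0
    mulr_ge0//.
- move=> n; rewrite ge0_integralZl//; first by rewrite intD mule0.
  by move=> th _; rewrite lee_fin.
Qed.

End bayes.

Theorem theorem5p1 (R : realType) (p : nat) (a b : R) :
  (3 <= p)%N -> 0 <= a -> 0 < b ->
  ((0 < a /\ p%:R / 2 - 1 <= b <= p%:R / 2) \/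
   (a = 0 /\ p%:R / 2 - 1 <= b < p%:R / 2)) ->
  strongly_admissible a b p.
Proof.
move=> p3 a0 b0 ab.
have pb : p%:R / 2 - 1 <= b by case: ab => -[_ /andP[]].
have ab' : 0 < a \/ a = 0 /\ b < p%:R / 2.
  by case: ab => [[? _]|[? /andP[_ ?]]]; [left|right].
have W := @integral_prior_weight_le R p a b (leq_trans (isT : 1 <= 3)%N p3) a0
  b0 pb ab'.
split; first exact: formal_posterior_exists (marg_dens_lty W).
move=> Q QP phi mphi [K phiK].
exact: (bayes_est_almost_admissible W QP mphi phiK).
Qed.
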